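(* Let $d \geq 1$ and let $P$ be a $d$-dimensional 0-1 matrix with at least two ones such that $ex(n, P, d) = O(n^{d-1})$. Then, as $n\to\infty$, \[ ex(n,F_{P,4},d+1) = \Theta(n\, \alpha(n)\, ex(n, P, d)),\qquad ex(n,F_{P,5},d+1) = \Theta(n\, 2^{\alpha(n)}\, ex(n, P, d)),\] and for every fixed integer $t \geq 1$, \[ ex(n,F_{P,2t+3},d+1) = ex(n, P, d)\, n\, 2^{(1/t!)\alpha(n)^{t} \pm o(\alpha(n)^{t})}.\]
   Context: $\alpha(n)$ denotes the inverse Ackermann function. A $d$-dimensional 0-1 matrix with sidelengths $n_1,\dots,n_d$ is a function $[n_1]\times\cdots\times[n_d]\to\{0,1\}$; entries with value 1 are ones. $M$ contains $P$ if there are, for each dimension $i$, strictly increasing maps from the $i$-th index set of $P$ into that of $M$ sending every one of $P$ to a one of $M$; otherwise $M$ avoids $P$. $ex(n,P,d)$ is the maximum number of ones in a $P$-avoiding $d$-dimensional 0-1 matrix with all sidelengths $n$. A $1$-row of a $(d+1)$-dimensional matrix is a set of entries all of whose coordinates other than the first are equal. If $P$ has $r$ ones, a $(P,s)$-formation is a set of $sr$ ones in a $(d+1)$-dimensional 0-1 matrix that can be partitioned into $s$ disjoint groups $G_1,\dots,G_s$ of $r$ ones each such that: any two groups have ones in exactly the same set of $1$-rows; for $i<j$ the maximum first coordinate of a one in $G_i$ is less than the minimum first coordinate of a one in $G_j$; and the set $S$ of points obtained by deleting the first coordinate of each of these ones (counting repeated points once) forms the pattern $P$, i.e. there are strictly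 increasing maps $\varphi_i$ from the $i$-th index set of $P$ to the integers with $S=\{(\varphi_1(x_1),\dots,\varphi_d(x_d)) : x \text{ a one of } P\}$. $F_{P,s}$ is the family of all $(P,s)$-formations, and $ex(n,F_{P,s},d+1)$ is the maximum number of ones in a $(d+1)$-dimensional 0-1 matrix of sidelength $n$ in every dimension containing no $(P,s)$-formation among its ones. *)

(* Defs.v *)
From mathcomp Require Import all_boot all_order all_algebra.
From mathcomp Require Import all_classical all_reals all_analysis.
Set Implicit Arguments.
Unset Strict Implicit.
Unset Printing Implicit Defensive.
Import Order.TTheory GRing.Theory Num.Theory.
Import numFieldNormedType.Exports.

(* [ack k] is the level A_{k+1} of the Ackermann hierarchy
   A_1(m) = 2m, A_{k+1}(m) = A_k^{(m)}(1). *)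
Fixpoint ack (k m : nat) : nat :=
  if k is k'.+1 then iter m (ack k') 1 else m.*2.

Lemma ack_gt k m : 0 < m -> m < ack k m.
Proof.
elim: k m => [|k IHk] m; first by move=> m0; rewrite /= -addnn -[ltnLHS]addn0 ltn_add2l.
elim: m => // -[|m] IHm _; first by rewrite /= IHk.
by rewrite [ack _ _]/=; apply: leq_ltn_trans (IHm isT) (IHk _ _); apply: ltn_trans (IHm isT).
Qed.

Lemma ack_ltS k m : ack k m < ack k m.+1.
Proof.
case: k => [|k] /=; first by rewrite doubleS ltnS.
apply: ack_gt; case: m => // m.
by apply: (leq_ltn_trans (leq0n m.+1)); exact: (@ack_gt k.+1 m.+1).
Qed.

Lemma ack3_gt k : k < ack k 3.
Proof.
have ack1 j : ack j 1 = 2 by elim: j.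
have ack2 j : ack j 2 = 4 by elim: j => //= j IHj; rewrite ack1.
elim: k => // k IHk; apply: leq_ltn_trans IHk _.
by rewrite [ltnRHS]/= ack1 ack2 ack_ltS.
Qed.

Lemma ack3_unbounded n : exists k, n <= ack k 3.
Proof. by exists n; exact/ltnW/ack3_gt. Qed.

(* alpha(n) = min {k >= 1 : A_k(3) >= n}; the successor undoes the index shift
   of [ack]. *)
Definition inv_ack (n : nat) : nat := (ex_minn (ack3_unbounded n)).+1.

(* Index sets are zero-based: [n_i] is rendered as 'I_(n i). *)
Notation mx_index n := {dffun forall i, 'I_(n i)}.
Notation mx01 n := {ffun mx_index n -> bool}.

Definition ones d (n : 'I_d -> nat) (M : mx01 n) : {set mx_index n} := [set x | M x].

Definition contains d (n p : 'I_d -> nat) (M : mx01 n) (P : mx01 p) : Prop :=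
  exists2 phi : forall i, 'I_(p i) -> 'I_(n i),
    forall i (a b : 'I_(p i)), a < b -> phi i a < phi i b
  & forall x : mx_index p, x \in ones P ->
      ([ffun i => phi i (x i)] : mx_index n) \in ones M.

Definition avoids d (n p : 'I_d -> nat) (M : mx01 n) (P : mx01 p) : Prop := ~ contains M P.

Definition cube (d n : nat) : 'I_d -> nat := fun=> n.
Arguments cube : clear implicits.

Definition ex_mx (n : nat) d (p : 'I_d -> nat) (P : mx01 p) : nat :=
  \max_(M : mx01 (cube d n) | `[< avoids M P >]) #|ones M|.

(* Deletes the first coordinate. Two entries lie in the same 1-row iff they have
   the same image, so images under [del1] also serve to name the 1-rows. *)
Definition del1 d (n : 'I_d.+1 -> nat) (x : mx_index n)
    : mx_index (fun i : 'I_d => n (lift ord0 i)) :=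
  [ffun i => x (lift ord0 i)].

(* [phi] takes integer values rather than values in [n i]: empty boundary
   slices of P then need not fit inside the index range of S. *)
Definition forms_pattern d (p : 'I_d -> nat) (P : mx01 p)
    (n : 'I_d -> nat) (S : {set mx_index n}) : Prop :=
  exists2 phi : forall i, 'I_(p i) -> int,
    forall i (a b : 'I_(p i)), a < b -> (phi i a < phi i b)%R
  & ((fun (y : mx_index n) (i : 'I_d) => Posz (y i)) @` [set` S]
     = (fun (x : mx_index p) (i : 'I_d) => phi i (x i)) @` [set` ones P])%classic.

Definition formation d (p : 'I_d -> nat) (P : mx01 p) (s : nat)
    (n : 'I_d.+1 -> nat) (F : {set mx_index n}) : Prop :=
  #|F| = s * #|ones P| /\
  exists G : 'I_s -> {set mx_index n},
  [/\ F = \bigcup_j G j,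
      (forall j, #|G j| = #|ones P|),
      (forall j k, j != k -> [disjoint G j & G k]) &
  [/\ (forall j k, [set del1 x | x in G j] = [set del1 x | x in G k]),
      (forall j k : 'I_s, j < k ->
         forall x y, x \in G j -> y \in G k -> x ord0 < y ord0) &
      forms_pattern P [set del1 x | x in F]]].

Definition avoids_formations d (n : 'I_d.+1 -> nat) (M : mx01 n)
    (p : 'I_d -> nat) (P : mx01 p) (s : nat) : Prop :=
  forall F : {set mx_index n}, F \subset ones M -> ~ formation P s F.

Definition ex_formation (n : nat) d (p : 'I_d -> nat) (P : mx01 p) (s : nat)
    : nat :=
  \max_(M : mx01 (cube d.+1 n) | `[< avoids_formations M P s >]) #|ones M|.

(* Main.v *)
(* Upper bounds. View the 1-rows as the rows of a 2-dimensional matrix, so that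
   any ex(n, P, d) + 1 rows contain a copy of P. Cut the columns into blocks and
   contract each block to one column. Rows within one block are handled by
   recursion; those starting or ending in a block avoid (s-1)-formations there,
   those passing through avoid (s-2)-formations and are counted by the contracted
   matrix. With block sizes taken from the Ackermann hierarchy this bounds the
   density by mu_s(i) = mu_{s-2}(i) (mu_s(i-1) + 1) + 2 mu_{s-1}(i), i = alpha(n).

   Lower bounds. Two ones of P differ in some coordinate i0, so it suffices to
   copy, along the other coordinates, a 2-dimensional matrix (in the first
   coordinate and i0) with no s-formation on two rows. Such matrices come from
   block sequences with few alternations between any two symbols, built by
   substituting a sequence of lower order into the blocks of one of lower level
   and shuffling the result into copies of one with shorter blocks. For s = 4
   only the first occurrences are shuffled, which adds 1 to the multiplicity. *)
Require Import Defs.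
From mathcomp Require Import all_boot zify.
Set Implicit Arguments.
Unset Strict Implicit.
Unset Printing Implicit Defensive.

(** * Recursive upper bounds *)

(** Both bounds rest on one recursion. The density of order s is multiplied at each level by the
    density of order s - 2, so its binary logarithm is, to leading order, the sum over the levels of
    the logarithm two orders below. Starting from the constant 1, t such summations give a binomial
    coefficient asymptotic to i^t / t!, the origin of the factor 1/t!. In the other parity the
    recursion starts from density 1, hence grows linearly first, and its logarithm stays negligible.
    The obstacle in the lower bound is that a substitution creates new alternations between symbols
    of a common block. Bounding only the runs of the larger symbol, and letting two symbols meet in
    a single block around which they alternate as little as possible, limits the loss to one run per
    order. Errors of the form o(alpha^t) are treated in the natural numbers, by comparing q-th
    powers for arbitrary q; real logarithms enter only at the very end. *)

Section Forms.
Variables (T : finType) (fam : {set T} -> Prop).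
Implicit Types (A : nat -> T -> bool) (X Y R : {set T}) (l u m s : nat).

Definition covers A l u R : Prop := forall x, x \in R -> exists2 y, l <= y < u & A y x.

(** Groups are given by cut points between intervals of columns in which every row of [R] has a one.
    This makes it easy to append or prepend a group; [form_choice] later recovers actual ones. *)
Fixpoint row_form A s R l u : Prop :=
  if s is s'.+1 then exists2 m, l <= m & covers A l m R /\ row_form A s' R m u
  else l <= u.

Definition avoid A s l u X : Prop :=
  forall R, fam R -> R \subset X -> ~ row_form A s R l u.

Definition weight A l u X : nat := \sum_(x in X) \sum_(l <= y < u) A y x.

Lemma covers_mono A l u l' u' R :
  l' <= l -> u <= u' -> covers A l u R -> covers A l' u' R.
Proof. by move=> ll uu cR x /cR[y yP Ay]; exists y => //; lia. Qed.

Lemma form_mono A s R l u l' u' :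
  l' <= l -> u <= u' -> row_form A s R l u -> row_form A s R l' u'.
Proof.
elim: s l l' => [|s IHs] l l' ll uu /=; first by lia.
case=> m lm [cm fm]; exists m; first by lia.
by split; [apply: covers_mono cm|apply: IHs fm].
Qed.

Lemma form_le A s R l u : row_form A s R l u -> l <= u.
Proof. by elim: s l => [|s IHs] l //= [m lm [_ /IHs]]; lia. Qed.

Lemma form_rcons A s R l m u :
  m <= u -> row_form A s R l m -> covers A m u R -> row_form A s.+1 R l u.
Proof.
elim: s l => [|s IHs] l mu.
  by move=> /= lm cm; exists u; [lia|split=> //; apply: covers_mono cm].
by case=> k lk [ck fk] cm; exists k => //; split=> //; exact: IHs fk cm.
Qed.

Lemma form_drop A s R l u : row_form A s.+1 R l u -> row_form A s R l u.
Proof. by case=> m lm [_ fm]; apply: form_mono fm. Qed.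

Lemma avoidS A s l u X : avoid A s l u X -> avoid A s.+1 l u X.
Proof. by move=> av R fR RX /form_drop; apply: av. Qed.

Lemma weight_le A l u X n : u <= l + n -> weight A l u X <= n * #|X|.
Proof.
move=> un; rewrite mulnC -sum_nat_const; apply: leq_sum => x _.
rewrite (@leq_trans (\sum_(l <= y < u) 1)) //; first by apply: leq_sum => y _; case: (A y x).
by rewrite sum_nat_const_nat muln1; lia.
Qed.

Section Split.
Variables (A : nat -> T -> bool) (c : nat -> nat) (b : nat) (X : {set T}).
Hypothesis c_mono : {homo c : i j / i <= j}.

Definition contract i x := has (A^~ x) (index_iota (c i) (c i.+1)).

Let early i x := has (contract^~ x) (iota 0 i).
Let late i x := has (contract^~ x) (iota i.+1 (b - i.+1)).
Let loc i := [set x in X | [&& contract i x, ~~ early i x & ~~ late i x]].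
Let start i := [set x in X | [&& contract i x, ~~ early i x & late i x]].
Let final i := [set x in X | [&& contract i x, early i x & ~~ late i x]].
Let mid i := [set x in X | [&& contract i x, early i x & late i x]].
Let glob := [set x in X | ~~ has (fun i => x \in loc i) (iota 0 b)].

Let early0 x : early 0 x = false. Proof. by []. Qed.

Let earlyP i j x : j < i -> contract j x -> early i x.
Proof. by move=> ji cj; apply/hasP; exists j => //; rewrite mem_iota. Qed.

Let lateP i j x : i < j < b -> contract j x -> late i x.
Proof. by move=> ij cj; apply/hasP; exists j => //; rewrite mem_iota; lia. Qed.

Lemma contractP i x : reflect (exists2 y, c i <= y < c i.+1 & A y x) (contract i x).
Proof.
by apply: (iffP hasP) => -[y yP Ay]; exists y; rewrite // mem_index_iota in yP *.
Qed.

Lemma covers_contract R i j : i <= j ->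
  covers contract i j R -> covers A (c i) (c j) R.
Proof.
move=> ij cR x /cR[k kP /contractP[y yP Ay]]; exists y => //.
by have := c_mono (x := i) (y := k); have := c_mono (x := k.+1) (y := j); lia.
Qed.

(** A one of the contracted matrix stands for a one of [A] in that block, so cuts at block
    boundaries pull a formation back. *)
Lemma form_contract s R i : i <= b ->
  row_form contract s R i b -> row_form A s R (c i) (c b).
Proof.
elim: s i => [|s IHs] i ib /=; first by move=> _; exact: c_mono.
case=> m im [cm fm]; have mb := form_le fm.
by exists (c m); [exact: c_mono|split; [exact: covers_contract cm|exact: IHs]].
Qed.

Lemma sum_card_sub (Y : {set T}) (S : nat -> {set T}) :
  (forall i, i < b -> S i \subset Y) ->
  (forall i j x, i < j -> j < b -> x \in S i -> x \in S j -> False) ->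
  \sum_(i < b) #|S i| <= #|Y|.
Proof.
move=> SY Sd; rewrite (eq_bigr (fun i : 'I_b => \sum_(x in Y) (x \in S i))).
  rewrite exchange_big -[#|Y|]mul1n mulnC -sum_nat_const; apply: leq_sum => x _ /=.
  have [i xi|no] := pickP (fun i : 'I_b => x \in S i).
    rewrite (bigD1 i) //= xi big1 // => j ji; apply/eqP; rewrite eqb0.
    apply/negP => xj; have : i != j :> nat by rewrite eq_sym.
    by rewrite neq_ltn => /orP[] h; [apply: Sd xi xj|apply: Sd xj xi].
  by rewrite big1 // => i _; rewrite no.
move=> i _; rewrite -sum1_card [LHS]big_mkcond [RHS]big_mkcond; apply: eq_bigr => x _.
by have /subsetP/(_ x) := SY i (ltn_ord i); case: (x \in S i) => [->|_] //; case: (x \in Y).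
Qed.

(* [F 0 i], ..., [F 3 i] are the rows that lie within block [i], start there,
   end there and pass through it; [G] consists of the rows meeting several
   blocks. A starting (ending) row has ones after (before) the block, so one
   group can be appended (prepended) to a formation on such rows. *)
Lemma split_blocks s : avoid A s.+2 (c 0) (c b) X ->
  exists (F : nat -> nat -> {set T}) (G : {set T}),
  [/\ weight A (c 0) (c b) X
        = \sum_(i < b) \sum_(k < 4) weight A (c i) (c i.+1) (F k i),
      [/\ \sum_(i < b) #|F 0 i| + #|G| <= #|X|, \sum_(i < b) #|F 1 i| <= #|G|,
        \sum_(i < b) #|F 2 i| <= #|G| & \sum_(i < b) #|F 3 i| <= weight contract 0 b G],
      avoid contract s.+2 0 b G,
      forall i, i < b -> [/\ avoid A s.+2 (c i) (c i.+1) (F 0 i),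
        avoid A s.+1 (c i) (c i.+1) (F 1 i), avoid A s.+1 (c i) (c i.+1) (F 2 i)
        & avoid A s (c i) (c i.+1) (F 3 i)]
    & F 2 0 = set0 /\ F 3 0 = set0].
Proof.
move=> av.
have c0 i : c 0 <= c i by exact: c_mono.
have cb i : i < b -> c i.+1 <= c b by move=> ib; exact: c_mono.
have globP i x : i < b -> x \in X -> contract i x -> early i x || late i x -> x \in glob.
  move=> ib xX ci el; rewrite inE xX /=; apply/hasPn => j; rewrite mem_iota add0n => /= jb.
  rewrite inE xX /=; apply/negP => /and3P[cj /negP ej /negP lj].
  have [ij|ij|ij] := ltngtP i j; first by apply: ej; apply: earlyP ci.
    by apply: lj; apply: lateP ci; lia.
  by move: el; rewrite ij => /orP[].
have covE R i m : (forall x, x \in R -> early i x) -> c i <= m -> covers A (c 0) m R.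
  move=> RE im x /RE/hasP[j]; rewrite mem_iota => /= jP /contractP[y yP Ay].
  by exists y => //; have := c0 j; have := c_mono (x := j.+1) (y := i); lia.
have covL R i m : i < b -> (forall x, x \in R -> late i x) -> m <= c i.+1 -> covers A m (c b) R.
  move=> ib RL im x /RL/hasP[j]; rewrite mem_iota => /= jP /contractP[y yP Ay].
  have := c_mono (x := j.+1) (y := b); have := c_mono (x := i.+1) (y := j).
  by exists y => //; lia.
exists (fun k => nth mid [:: loc; start; final; mid] k), glob; split => /=.
- rewrite (eq_bigr (fun i : 'I_b => weight A (c i) (c i.+1) X)); last first.
    move=> i _; rewrite !big_ord_recr big_ord0 /= add0n /weight.
    rewrite ![\sum_(x in _) _]big_mkcond /= -!big_split /=; apply: eq_bigr => x _.
    rewrite !inE; case: (x \in X) => //=.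
    (* The values of [early] and [late] put a row with a one in the block into exactly one of the
       four classes. *)
    have [|/hasPn nc] := boolP (contract i x).
      by case: (early i x); case: (late i x); rewrite /= ?addn0.
    rewrite /= addn0 big_nat big1 // => y yP.
    by rewrite (negbTE (nc y _)) // mem_index_iota.
  rewrite /weight [RHS]exchange_big; apply: eq_bigr => x _ /=.
  rewrite -(big_mkord xpredT (fun i => \sum_(c i <= y < c i.+1) A y x)).
  elim: {av globP covE covL cb} b => [|n IHn]; first by rewrite !big_geq.
  by rewrite big_nat_recr //= -IHn -big_cat_nat //= c_mono.
- split.
  + pose Y := X :\: glob.
    have -> : #|X| = #|Y| + #|glob|.
      rewrite addnC -(cardsID glob X); congr (_ + _); congr #|pred_of_set _|.
      by apply/setP => x; rewrite !inE; case: (x \in X).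
    rewrite leq_add2r; apply: sum_card_sub => [i ib|i j x ij jb].
      apply/subsetP => x xi; rewrite !inE; move: (xi); rewrite inE => /andP[-> _] /=.
      rewrite andbT negbK; apply/hasP; exists i => //.
      by rewrite mem_iota /= add0n ib.
    by rewrite !inE => /and4P[_ ci _ _] /and4P[_ _ /negP ej _]; apply: ej; apply: earlyP ci.
  + apply: sum_card_sub => [i ib|i j x ij jb].
      by apply/subsetP => x; rewrite inE => /and4P[? ? _ l]; apply: (globP i); rewrite ?l ?orbT.
    by rewrite !inE => /and4P[_ ci _ _] /and4P[_ _ /negP ej _]; apply: ej; apply: earlyP ci.
  + apply: sum_card_sub => [i ib|i j x ij jb].
      by apply/subsetP => x; rewrite inE => /and4P[? ? e _]; apply: (globP i); rewrite ?e.
    by rewrite !inE => /and4P[_ _ _ /negP li] /and4P[_ cj _ _]; apply: li; apply: lateP cj; lia.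
  (* A row passing through block i is a global row with a one in column i of the contracted
     matrix. *)
  + rewrite /weight exchange_big /= big_mkord; apply: leq_sum => i _.
    rewrite -sum1_card [leqLHS]big_mkcond [leqRHS]big_mkcond; apply: leq_sum => x _.
    case: ifP => //; rewrite inE => /and4P[xX ci ei li].
    by rewrite (globP i) ?ci // ei.
- move=> R fR Rg fm; apply: (av R fR); last exact: form_contract fm.
  by apply: subset_trans Rg _; apply/subsetP => x; rewrite inE => /andP[].
- have subX P : [set x in X | P x] \subset X by apply/subsetP => x; rewrite inE => /andP[].
  move=> i ib; split=> R fR RS fm; have RX := subset_trans RS (subX _); apply: (av R fR RX).
  + by apply: form_mono fm; rewrite ?cb.
  + apply: form_rcons (c_mono (x := i.+1) (y := b) ib) _ (covL R i _ ib _ (leqnn _)).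
      by apply: form_mono fm; rewrite ?c0.
    by move=> x /(subsetP RS); rewrite inE => /and4P[].
  + exists (c i) => //; split; last by apply: form_mono fm; rewrite ?cb.
    by apply: covE (leqnn _) => x /(subsetP RS); rewrite inE => /and4P[].
  + exists (c i) => //; split; first by apply: covE (leqnn _) => x /(subsetP RS); rewrite inE => /and4P[].
    apply: form_rcons (c_mono (x := i.+1) (y := b) ib) fm (covL R i _ ib _ (leqnn _)).
    by move=> x /(subsetP RS); rewrite inE => /and4P[].
- by split; apply/setP => x; rewrite !inE early0 andbF andbF.
Qed.

End Split.
End Forms.

(** * Bounds linear in the numbers of rows and columns *)

Section Bounds.
Variables (T : finType) (fam : {set T} -> Prop) (K : nat).
Hypothesis famK : forall X : {set T}, K < #|X| -> exists2 R, fam R & R \subset X.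

(** [m.-1] avoids rounding losses: b blocks of width B satisfy (b - 1) * B <= m - 1, so a
    coefficient of size B for the contracted matrix costs only a constant multiple of K * (m -
    1). *)
Definition bnd s Q P m := forall A l u (X : {set T}), u = l + m ->
  avoid fam A s l u X -> weight A l u X <= Q * #|X| + P * K * m.-1.

Lemma bnd_weak s Q P Q' P' m : Q <= Q' -> P <= P' -> bnd s Q P m -> bnd s Q' P' m.
Proof.
move=> QQ PP bd A l u X um av; apply: leq_trans (bd _ _ _ _ um av) _.
by rewrite leq_add // leq_mul // leq_mul.
Qed.

Lemma bnd_trivial s Q P m : m <= Q -> bnd s Q P m.
Proof.
move=> mQ A l u X um _; apply: leq_trans (leq_addr _ _).
by apply: weight_le; rewrite um leq_add2l.
Qed.

Lemma weight_column A l u (X : {set T}) : u = l.+1 -> avoid fam A 1 l u X -> weight A l u X <= K.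
Proof.
move=> -> av; rewrite leqNgt; apply/negP => Kw.
have [|R fR /subsetP RX] := famK (X := [set x in X | A l x]).
  apply: leq_trans Kw _; rewrite /weight -sum1_card [leqLHS]big_mkcond [leqRHS]big_mkcond.
  by apply: leq_sum => x _; rewrite big_nat1 inE; case: (x \in X) => //; case: (A l x).
apply: (av R fR); first by apply/subsetP => x /RX; rewrite inE => /andP[].
exists l.+1 => //; split=> //= x /RX; rewrite inE => /andP[_ Ax].
by exists l; rewrite // leqnn /=.
Qed.

Lemma weight_set0 A l u : weight A l u (set0 : {set T}) = 0.
Proof. by rewrite /weight big_set0. Qed.

Lemma weight_one A l u (X : {set T}) : u = l.+1 -> weight A l u X <= #|X|.
Proof. by move=> ->; rewrite -[#|X|]mul1n weight_le // addn1. Qed.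

Lemma sum_succ_le m (F : nat -> nat) : F 0 = 0 -> (forall i, F i <= K) -> \sum_(i < m) F i <= K * m.-1.
Proof.
move=> F0 FK; case: m => [|m]; first by rewrite big_ord0.
rewrite big_ord_recl F0 add0n mulnC -[m in leqRHS]card_ord -sum_nat_const.
by apply: leq_sum.
Qed.

(** Blocks are single columns. The first one of each row is charged to the row. All others lie in
    ending or passing rows, which avoid 1-formations in their column: at most [K] per class and
    column, and none in the first column. *)
Lemma bnd2 m : bnd 2 1 2 m.
Proof.
move=> A l u X um av.
have cm : {homo addn l : i j / i <= j} by move=> i j; rewrite leq_add2l.
rewrite um -{1}[l]addn0; rewrite um -{1}[l]addn0 in av.
have [F [G [-> [c0 c1 _ _] _ avF [F20 F30]]]] := split_blocks cm av.
pose w (k i : nat) := weight A (l + i) (l + i.+1) (F k i).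
rewrite (eq_bigr (fun i : 'I_m => w 0 i + w 1 i + (w 2 i + w 3 i))); last first.
  by move=> i _; rewrite !big_ord_recr big_ord0 /= add0n addnA.
rewrite !big_split /= mul1n -mulnA mul2n -addnn leq_add //.
  have ws k : \sum_(i < m) w k i <= \sum_(i < m) #|F k i|.
    by apply: leq_sum => i _; apply: weight_one; rewrite addnS.
  by apply: leq_trans c0; rewrite leq_add // (leq_trans (ws 1)).
have avi i k : i < m -> k = 2 \/ k = 3 -> w k i <= K.
  move=> im kE; have [_ _ a2 a3] := avF _ im.
  by case: kE => ->; apply: weight_column; rewrite ?addnS // -addnS //; exact: avoidS.
have sw k : k = 2 \/ k = 3 -> \sum_(i < m) w k i <= K * m.-1.
  move=> kE; rewrite (eq_bigr (fun i : 'I_m => if i < m then w k i else 0)); last first.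
    by move=> i _; rewrite ltn_ord.
  apply: (@sum_succ_le _ (fun i => if i < m then w k i else 0)) => [|i].
    by case: ifP => // _; rewrite /w; case: kE => ->; rewrite ?F20 ?F30 weight_set0.
  by case: ifP => // im; apply: avi.
by rewrite leq_add // sw //; [left|right].
Qed.

(** As for [bnd2], with both the first and the last one of a row charged to the row, so that only
    the passing rows cost [K] per column. *)
Lemma bnd3 m : bnd 3 2 1 m.
Proof.
move=> A l u X um av.
have cm : {homo addn l : i j / i <= j} by move=> i j; rewrite leq_add2l.
rewrite um -{1}[l]addn0; rewrite um -{1}[l]addn0 in av.
have [F [G [-> [c0 c1 c2 _] _ avF [F20 F30]]]] := split_blocks cm av.
pose w (k i : nat) := weight A (l + i) (l + i.+1) (F k i).
rewrite (eq_bigr (fun i : 'I_m => w 0 i + w 1 i + w 2 i + w 3 i)); last first.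
  by move=> i _; rewrite !big_ord_recr big_ord0 /= add0n.
rewrite !big_split /= mul1n.
have ws k : \sum_(i < m) w k i <= \sum_(i < m) #|F k i|.
  by apply: leq_sum => i _; apply: weight_one; rewrite addnS.
have w3 : \sum_(i < m) w 3 i <= K * m.-1.
  rewrite (eq_bigr (fun i : 'I_m => if i < m then w 3 i else 0)); last first.
    by move=> i _; rewrite ltn_ord.
  apply: (@sum_succ_le _ (fun i => if i < m then w 3 i else 0)) => [|i].
    by case: ifP => // _; rewrite /w F30 weight_set0.
  case: ifP => // im; have [_ _ _ a3] := avF _ im.
  by apply: weight_column; rewrite ?addnS // -addnS.
apply: leq_trans (leq_add (leq_add (leq_add (ws 0) (ws 1)) (ws 2)) w3) _.
rewrite leq_add2r; move: c0 c1 c2.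
move: (\sum_(i < m) _) (\sum_(i < m) _) (\sum_(i < m) _); lia.
Qed.

(** A local row costs [Q]. A global row costs [Q1] in its starting and in its ending block, and [Q2]
    in each block it passes through, of which there are about [Q'] per row. As
    [2 * Q1 + Q2 * Q' <= Q], the density does not rise when the number of columns does; only the
    coefficient of [K] grows. *)
Lemma bnd_step s B Q P Q1 P1 Q2 P2 Q' P' P'' m : 0 < B ->
  (forall m', m' <= B -> bnd s.+2 Q P m') ->
  (forall m', m' <= B -> bnd s.+1 Q1 P1 m') ->
  (forall m', m' <= B -> bnd s Q2 P2 m') ->
  (forall b, b <= m -> b.-1 * B < m -> bnd s.+2 Q' P' b) ->
  P' <= P'' * B -> 2 * Q1 + Q2 * Q' <= Q ->
  bnd s.+2 Q (P + 2 * P1 + P2 + Q2 * P'') m.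
Proof.
move=> B0 h h1 h2 h' PB QQ A l u X um av.
have [m0|m0] := posnP m.
  by apply: leq_trans (leq_addr _ _); apply: leq_trans (@weight_le T A l u X 0 _) _; lia.
(* b is m / B rounded up; truncation at u shortens the last block. *)
pose c i := minn (l + i * B) u; pose b := (m.-1 %/ B).+1.
have cm : {homo c : i j / i <= j}.
  by move=> i j ij; have := leq_mul ij (leqnn B); rewrite /c; lia.
have bB : b.-1 * B < m by have := leq_divM m.-1 B; rewrite /b /=; lia.
have mB : m <= b * B by have := ltn_ceil m.-1 B0; rewrite -/b; lia.
have bm : b <= m by have := leq_pmulr b.-1 B0; lia.
have c0 : c 0 = l by rewrite /c; lia.
have cb : c b = u by rewrite /c; lia.
pose len i := c i.+1 - c i.
have len_gt0 i : i < b -> 0 < len i.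
  move=> ib; have : i * B <= b.-1 * B by rewrite leq_mul2r; lia.
  by rewrite /len /c mulSn; lia.
have lenB i : len i <= B by rewrite /len /c mulSn; lia.
have clen i : c i.+1 = c i + len i by rewrite subnKC // cm.
have sum_len : \sum_(i < b) (len i).-1 + b = m.
  have : \sum_(i < b) len i = u - l.
    rewrite -cb -c0; elim: (b) => [|n IHn]; first by rewrite big_ord0 subnn.
    by rewrite big_ord_recr /= IHn; have := cm _ _ (leq0n n); have := clen n; lia.
  rewrite um addKn => E; rewrite -[RHS]E -[X in _ + X]muln1 -[X in X * 1]card_ord -sum_nat_const.
  by rewrite -big_split /=; apply: eq_bigr => i _; have := len_gt0 i (ltn_ord i); lia.
rewrite -c0 -cb in av *.
have [F [G [-> [e0 e1 e2 e3] avG avF _]]] := split_blocks cm av.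
have wG := h' _ bm bB _ _ _ _ (esym (add0n b)) avG.
pose w (k i : nat) := weight A (c i) (c i.+1) (F k i).
rewrite (eq_bigr (fun i : 'I_b => w 0 i + w 1 i + w 2 i + w 3 i)); last first.
  by move=> i _; rewrite !big_ord_recr big_ord0 /= add0n.
rewrite !big_split /=.
have sumw k q p : (forall i, i < b -> w k i <= q * #|F k i| + p * K * (len i).-1) ->
    \sum_(i < b) w k i <= q * (\sum_(i < b) #|F k i|) + p * K * m.-1.
  move=> wk; apply: (@leq_trans (\sum_(i < b) (q * #|F k i| + p * K * (len i).-1))).
    by apply: leq_sum => i _; exact: wk.
  rewrite big_split /= -!big_distrr /= leq_add2l leq_mul2l; apply/orP; right; have : 0 < b by []; move: sum_len; rewrite [X in X + b = m](eq_bigr (fun i : 'I_b => (len i).-1)) //; lia.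
have w0 : \sum_(i < b) w 0 i <= Q * (\sum_(i < b) #|F 0 i|) + P * K * m.-1.
  by apply: sumw => i ib; have [a _ _ _] := avF _ ib; exact: (h (len i)).
have w1 : \sum_(i < b) w 1 i <= Q1 * (\sum_(i < b) #|F 1 i|) + P1 * K * m.-1.
  by apply: sumw => i ib; have [_ a _ _] := avF _ ib; exact: (h1 (len i)).
have w2 : \sum_(i < b) w 2 i <= Q1 * (\sum_(i < b) #|F 2 i|) + P1 * K * m.-1.
  by apply: sumw => i ib; have [_ _ a _] := avF _ ib; exact: (h1 (len i)).
have w3 : \sum_(i < b) w 3 i <= Q2 * (\sum_(i < b) #|F 3 i|) + P2 * K * m.-1.
  by apply: sumw => i ib; have [_ _ _ a] := avF _ ib; exact: (h2 (len i)).
have q1 := leq_mul (leqnn Q1) e1; have q2 := leq_mul (leqnn Q1) e2.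
have q3 := leq_mul (leqnn Q2) (leq_trans e3 wG).
have q4 : P' * K * b.-1 <= P'' * K * m.-1.
  apply: (@leq_trans (P'' * K * (B * b.-1))).
    by rewrite mulnA (mulnAC P'') leq_mul // leq_mul.
  by rewrite leq_mul //; lia.
have q5 := leq_mul (leqnn Q2) q4.
have q6 := leq_mul QQ (leqnn #|G|).
have q7 := leq_mul (leqnn Q) e0.
apply: leq_trans (leq_add (leq_add (leq_add w0 w1) w2) w3) _.
rewrite !mulnDl !mulnDr in q3 q6 q7 *.
rewrite -!mulnA in q3 q5 q6 q7 *; lia.
Qed.

End Bounds.

(** * Block sizes from the Ackermann hierarchy *)

Lemma ack_rec k m : ack k.+1 m.+1 = ack k (ack k.+1 m).
Proof. by []. Qed.

Lemma leq_ack k m n : m <= n -> ack k m <= ack k n.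
Proof. by elim: n => [|n IHn]; [case: m|rewrite leq_eqVlt ltnS => /predU1P[->//|/IHn h]; exact: leq_trans h (ltnW (ack_ltS k n))]. Qed.

Lemma ack_double k m : m.*2 <= ack k m.
Proof.
elim: k m => // k IHk; elim=> // m IHm; rewrite ack_rec.
apply: leq_trans (IHk _); rewrite leq_double.
by case: m IHm => // m; apply: leq_trans; rewrite -addnn; lia.
Qed.

Lemma leq_ack_lvl k l m : k <= l -> ack k m <= ack l m.
Proof.
have ackS i n : ack i n <= ack i.+1 n.
  elim: n => [|n IHn]; first by case: i.
  rewrite ack_rec; apply: leq_ack; case: n IHn => // n _.
  by have := ack_double i.+1 n.+1; rewrite -addnn; lia.
by move=> /subnK <-; elim: (l - k) => // n IHn; exact: leq_trans IHn (ackS _ _).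
Qed.

Lemma ack1 k : ack k 1 = 2.
Proof. by elim: k. Qed.

(* The density of [s.+2]-formation-free matrices with at most [ack i j ^ c]
   columns, [j] bounded; [c] makes room for the factor [j ^ s] in [bnd_mu]. *)
Fixpoint mu c s : nat -> nat :=
  match s with
  | 0 => fun=> 1
  | s1.+1 => if s1 is s2.+1 then
      fix mu_s i := if i is i'.+1 then 2 * mu c s1 i + mu c s2 i * (mu_s i').+1 else 2 ^ c
    else fun=> 2
  end.

Lemma mu_rec c s i : mu c s.+2 i.+1 = 2 * mu c s.+1 i.+1 + mu c s i.+1 * (mu c s.+2 i).+1.
Proof. by []. Qed.

Lemma mu_gt0 c s i : 0 < mu c s i.
Proof.
elim/ltn_ind: s i => -[|[|s]] IHs //; elim=> [|i IHi]; first by rewrite expn_gt0.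
by rewrite mu_rec; have := IHs s.+1 (ltnSn _) i.+1; lia.
Qed.

(** Since [ack i 1 = 2], this makes the case j = 1 of [bnd_mu] trivial. *)
Lemma mu_ge_exp c s i : 2 ^ c <= mu c s.+2 i.
Proof.
elim: i => // i IHi; rewrite mu_rec; have := leq_mul (mu_gt0 c s i.+1) IHi.
by rewrite mulnS; lia.
Qed.

Section Upper.
Variables (T : finType) (fam : {set T} -> Prop) (K : nat).
Hypothesis famK : forall X : {set T}, K < #|X| -> exists2 R, fam R & R \subset X.

(** Induction on s, then i, then j. Going from j to j + 1 at level i + 1 uses blocks of width
    [w ^ c], where w is [ack i.+1 j]; as [ack i.+1 j.+1 = ack i w], the contracted matrix falls
    under level i with parameter w. Its coefficient [w ^ s] is absorbed by the block width, whence
    [s <= c]. At level 0, [ack 0 w] is only twice w, so at most [2 ^ c] blocks remain and the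
    trivial bound applies; the last hypothesis records this. *)
Lemma bnd_mu c s i j m : s <= c -> 0 < j -> m <= ack i j ^ c -> (i = 0 -> m <= 2 ^ c) ->
  bnd fam K s.+2 (mu c s i) (2 * mu c s i * j ^ s) m.
Proof.
elim/ltn_ind: s i j m => -[|[|s]] IHs i j m sc j0 mij m0.
- exact: bnd_weak (@bnd2 _ _ _ famK m).
- by apply: bnd_weak (@bnd3 _ _ _ famK m) => //=; lia.
elim: i j m j0 mij m0 => [|i IHi] j m j0 mij m0; first exact/bnd_trivial/m0.
elim: j j0 m mij {m0} => // -[|j] IHj _ m mij.
  by apply: bnd_trivial; apply: leq_trans mij _; rewrite ack1 mu_ge_exp.
pose w := ack i.+1 j.+1; pose B := w ^ c.
have w0 : 0 < w by rewrite -[0]/(0.*2) (leq_trans _ (ack_double _ _)).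
have B0 : 0 < B by rewrite expn_gt0 w0.
have {}IHj m' : m' <= B -> _ := IHj isT m'.
have IH1 m' : m' <= B -> bnd fam K s.+3 (mu c s.+1 i.+1) (2 * mu c s.+1 i.+1 * j.+1 ^ s.+1) m'.
  by move=> mB; apply: IHs => //; exact: ltnW.
have IH2 m' : m' <= B -> bnd fam K s.+2 (mu c s i.+1) (2 * mu c s i.+1 * j.+1 ^ s) m'.
  by move=> mB; apply: IHs => //; lia.
have IHb b : b <= m -> b.-1 * B < m ->
    bnd fam K s.+4 (mu c s.+2 i) (2 * mu c s.+2 i * w ^ s.+2) b.
  move=> bm bB; apply: IHi => // [|i0]; first exact: leq_trans bm mij.
  rewrite ack_rec -/w {1}i0 [ack 0 _]/= -muln2 mulnC expnMn -/B in mij.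
  by have := leq_trans bB mij; rewrite ltn_mul2r; lia.
have wB : 2 * mu c s.+2 i * w ^ s.+2 <= 2 * mu c s.+2 i * B.
  by rewrite leq_mul2l leq_pexp2l ?orbT.
have Qle : 2 * mu c s.+1 i.+1 + mu c s i.+1 * mu c s.+2 i <= mu c s.+2 i.+1.
  by rewrite mu_rec leq_add2l leq_mul2l leqnSn orbT.
apply: bnd_weak (bnd_step B0 IHj IH1 IH2 IHb wB Qle) => //.
have e0 : 0 < j.+1 ^ s.+1 by rewrite expn_gt0.
have e1 : j.+1 ^ s <= j.+1 ^ s.+1 by rewrite leq_pexp2l.
(* The increase of the power frees [j.+1 ^ s.+1], which times twice the density covers the new
   coefficients of [K]; the summand 1 in [mu_rec] pays for the passing rows. *)
have e2 : j.+1 ^ s.+2 + j.+1 ^ s.+1 <= j.+2 ^ s.+2.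
  by rewrite expnS -mulSnr [j.+2 ^ _]expnS leq_mul2l leq_exp2r // leqnSn.
rewrite mu_rec; set M := 2 * _ + _.
have := leq_mul (leqnn (2 * M)) e2.
have := leq_mul (leqnn (mu c s i.+1)) e1.
have := leq_mul (leqnn (mu c s i.+1 * mu c s.+2 i)) e0.
rewrite /M; move: (mu c s.+1 i.+1) (mu c s i.+1) (mu c s.+2 i) => x y z.
move: (j.+2 ^ _) (j.+1 ^ s.+2) (j.+1 ^ s.+1) (j.+1 ^ s) => p3 p2 p1 p0.
nia.
Qed.

(** The choice j = 3 matches the definition of [inv_ack]; c = s + 1 is at least s and positive even
    for s = 0. *)
Lemma weight_mu s i n (A : nat -> T -> bool) (X : {set T}) : n <= ack i.+1 3 ->
  avoid fam A s.+2 0 n X ->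
  weight A 0 n X <= mu s.+1 s i.+1 * (#|X| + 2 * 3 ^ s * K * n).
Proof.
move=> ni av; have na : n <= ack i.+1 3 ^ s.+1.
  by rewrite (leq_trans ni) // -{1}[ack _ _]expn1 leq_pexp2l // (leq_trans _ (ack_double _ _)).
have level_pos : i.+1 = 0 -> n <= 2 ^ s.+1 by [].
have := bnd_mu (i := i.+1) (j := 3) (leqnSn s) isT na level_pos.
move=> /(_ A 0 n X (esym (add0n n)) av) /leq_trans -> //.
by rewrite mulnDr leq_add2l (mulnC 2) -!mulnA !leq_mul2l leq_pred !orbT.
Qed.
End Upper.

(** * Growth of the density recursion *)

Lemma mu2_le c i : mu c 2 i <= 2 ^ c + 5 * i.
Proof.
elim: i => [|i IHi]; first exact: leq_addr.
by rewrite mu_rec [mu c 1 _]/= [mu c 0 _]/=; lia.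
Qed.

(** The recurrence doubles [mu c 3] and adds a term linear in i. The terms added on the left absorb
    that inhomogeneous part, so that the whole left side at most doubles per level. *)
Lemma mu3_le c i : mu c 3 i + 10 * i + 2 ^ c * 2 + 32 <= (2 ^ c * 3 + 32) * 2 ^ i.
Proof.
elim: i => [|i IHi]; first by rewrite /= expn0; lia.
by rewrite mu_rec expnS mulnCA; have := mu2_le c i.+1; rewrite [mu c 1 _]/=; lia.
Qed.

Lemma leq_expl m n t : m <= n -> m ^ t <= n ^ t.
Proof. by move=> mn; case: t => // t; rewrite leq_exp2r. Qed.

Lemma poly_le_exp q : exists C, forall n, n.+1 ^ q <= 2 ^ (n + C).
Proof.
case: q => [|q]; first by exists 0 => n; rewrite expn_gt0.
exists (q.+1 * q.+1) => n; rewrite expnD.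
apply: (@leq_trans ((2 ^ (n %/ q.+1) * q.+1) ^ q.+1)).
  rewrite leq_exp2r //; apply: leq_trans (ltn_ceil n (ltn0Sn q)) _.
  by rewrite leq_mul2r ltn_expl.
rewrite expnMn -expnM leq_mul //; first by rewrite leq_pexp2l // leq_divM.
by rewrite expnM leq_exp2r // ltnW // ltn_expl.
Qed.

(* [x i] is at most [2 ^ (e i + o(i ^ t))]. *)
Definition growth (e : nat -> nat) t (x : nat -> nat) : Prop :=
  forall q, exists C, forall i, x i ^ q <= 2 ^ (q * e i + i.+1 ^ t + C).

Lemma growth_mono e e' t x : (forall i, e i <= e' i) -> growth e t x -> growth e' t x.
Proof.
move=> ee gx q; have [C hC] := gx q; exists C => i; apply: leq_trans (hC i) _.
by rewrite leq_pexp2l // !leq_add2r leq_mul2l ee orbT.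
Qed.

(** A main term of degree t is an error of degree t + 1: [q.+1 * i.+1 ^ t] is at most [i.+1 ^ t.+1]
    once i >= q, and bounded before. *)
Lemma growth_absorb e t x : (forall i, e i <= i.+1 ^ t) -> growth e t x -> growth (fun=> 0) t.+1 x.
Proof.
move=> et gx q; have [C hC] := gx q; exists (q.+1 ^ t.+1 + C) => i.
apply: leq_trans (hC i) _; rewrite leq_pexp2l // muln0 add0n addnA leq_add2r.
apply: (@leq_trans (q.+1 * i.+1 ^ t)); first by rewrite mulSn addnC leq_add2l leq_mul2l et orbT.
have [qi|iq] := leqP q i.
  by rewrite (leq_trans _ (leq_addr _ _)) // expnS leq_mul2r ltnS qi orbT.
by rewrite (leq_trans _ (leq_addl _ _)) // [leqRHS]expnS leq_mul2l leq_expl ?orbT // ltnW.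
Qed.

Lemma growth_cst e t k : growth e t (fun=> k).
Proof.
move=> q; exists (k * q) => i; apply: (@leq_trans (2 ^ (k * q))); last by rewrite leq_pexp2l // leq_addl.
by rewrite expnM; case: q => // q; rewrite leq_exp2r // ltnW // ltn_expl.
Qed.

Lemma growthD e t x y : growth e t x -> growth e t y -> growth e t (fun i => x i + y i).
Proof.
move=> gx gy q; have [C hC] := gx q; have [D hD] := gy q.
exists (q + C + D) => i; apply: (@leq_trans ((2 * maxn (x i) (y i)) ^ q)).
  by case: q {hC hD} => // q; rewrite leq_exp2r //; lia.
have := hC i; have := hD i; rewrite expnMn /maxn; case: ifP => _ h1 h2.
  apply: leq_trans (leq_mul (leqnn _) h1) _; rewrite -expnD leq_pexp2l //; lia.
by apply: leq_trans (leq_mul (leqnn _) h2) _; rewrite -expnD leq_pexp2l //; lia.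
Qed.

Lemma affine_rec (a b x : nat -> nat) n : (forall i, 0 < a i) -> x 0 <= b 0 ->
  (forall i, x i.+1 <= a i.+1 * x i + b i.+1) ->
  x n <= (\prod_(i < n) a i.+1) * \sum_(i < n.+1) b i.
Proof.
move=> a0 x0 xS; elim: n => [|n IHn]; first by rewrite big_ord0 big_ord_recr big_ord0 mul1n.
apply: leq_trans (xS n) _; rewrite [in leqRHS]big_ord_recr [in leqRHS]big_ord_recr /= mulnDr leq_add //.
  by rewrite mulnAC mulnC leq_mul2r IHn orbT.
by rewrite leq_pmull // muln_gt0 a0 andbT prodn_gt0.
Qed.

(** In an affine recurrence the exponents of the coefficients add up over the levels, which raises
    the degree by one; the inhomogeneous term enters the error only. *)
Lemma growth_rec (a b x e : nat -> nat) t : 0 < t ->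
  (forall i, 0 < a i) -> x 0 <= b 0 ->
  (forall i, x i.+1 <= a i.+1 * x i + b i.+1) ->
  growth e t a -> growth (fun=> 0) t.+1 b ->
  growth (fun n => \sum_(i < n) e i.+1) t.+1 x.
Proof.
(* Three errors of size [n.+1 ^ t.+1] arise; working with 4q-th powers and comparing fourth powers
   leaves room for them. *)
move=> t0 a0 x0 xS ga gb q; have [Ca hCa] := ga (4 * q); have [Cb hCb] := gb (4 * q).
have [Cp hCp] := poly_le_exp (4 * q).
have [->|q0] := posnP q; first by exists 0 => n; rewrite expn_gt0.
exists (Ca.+1 ^ 2 + Cp + Cb) => n.
rewrite -(@leq_exp2r _ _ 4) // -!expnM (mulnC q 4).
have := affine_rec n a0 x0 xS; rewrite -(@leq_exp2r _ _ (4 * q)) ?muln_gt0 // => /leq_trans; apply.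
have sum_b : (\sum_(i < n.+1) b i) ^ (4 * q) <= 2 ^ (n + Cp + n.+1 ^ t.+1 + Cb).
  pose B := \max_(i < n.+1) b i.
  have [j Bj] : {j : 'I_n.+1 | B = b j} by apply: eq_bigmax; rewrite card_ord.
  apply: (@leq_trans ((n.+1 * B) ^ (4 * q))).
    rewrite leq_exp2r ?muln_gt0 // -[n.+1 in leqRHS]card_ord -sum_nat_const.
    by apply: leq_sum => i _; exact: leq_bigmax.
  rewrite expnMn -addnA expnD leq_mul ?hCp // Bj; apply: leq_trans (hCb j) _.
  by rewrite leq_pexp2l // muln0 add0n leq_add2r leq_exp2r.
have prod_a : (\prod_(i < n) a i.+1) ^ (4 * q)
    <= 2 ^ (4 * q * (\sum_(i < n) e i.+1) + n * n.+1 ^ t + Ca * n).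
  elim: (n) => [|k IHk]; first by rewrite !big_ord0 exp1n expn_gt0.
  rewrite !big_ord_recr /= expnMn; apply: leq_trans (leq_mul IHk (hCa k.+1)) _.
  rewrite -expnD leq_pexp2l // mulnDr mulnS.
  have h : k * k.+1 ^ t <= k * k.+2 ^ t by rewrite leq_mul2l leq_exp2r // leqnSn orbT.
  rewrite [k.+1 * _]mulSn.
  move: (k * k.+1 ^ t) (k * k.+2 ^ t) (k.+2 ^ t) h => u v w h.
  move: (\sum_(i < k) _) (4 * q) => Z q4; lia.
rewrite expnMn; apply: leq_trans (leq_mul prod_a sum_b) _.
rewrite -expnD leq_pexp2l //.
have h1 : n * n.+1 ^ t <= n.+1 ^ t.+1 by rewrite expnS leq_mul2r leqnSn orbT.
have h2 : n.+1 ^ 2 <= n.+1 ^ t.+1 by rewrite leq_pexp2l.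
have h3 : Ca * n + n <= n.+1 ^ 2 + Ca.+1 ^ 2 by nia.
move: (Ca.+1 ^ 2) h3 h1 h2 => C2; move: (n.+1 ^ t.+1) (n * n.+1 ^ t) (n.+1 ^ 2) (Ca * n) => p r p2 ca.
by rewrite (mulnC _ 4) !mulnDr !mulnA; lia.
Qed.

(** The hockey-stick identity without its first term. *)
Lemma sum_bin t n : \sum_(i < n) 'C(i.+1 + t, t) <= 'C(n + t.+1, t.+1).
Proof.
elim: n => [|n IHn]; first by rewrite big_ord0.
by rewrite big_ord_recr /= [n.+1 + t.+1]addSn binS addSnnS leq_add.
Qed.

Lemma bin_le_exp n t : 'C(n + t, t) <= n.+1 ^ t.
Proof.
elim: t => [|t IHt] in n *; first by rewrite bin0.
elim: n => [|n IHn]; first by rewrite add0n binn exp1n.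
rewrite addSn binS -[in X in _ + X]addSnnS [n.+2 ^ _]expnS mulSn addnC leq_add //.
by apply: leq_trans IHn _; rewrite expnS leq_mul2l leq_expl ?orbT.
Qed.

(** The coefficient in the recurrence of [mu c s.+2] is [mu c s]. For odd s the exponents start from
    a linear one and sum to binomial coefficients by [sum_bin]; for even s the linear start has a
    negligible exponent, which stays negligible under summation. Either parity, seen one degree
    higher through [growth_absorb], supplies the inhomogeneous term of the next recurrence. *)
Lemma mu_growth c t :
  growth (fun=> 0) t.+1 (mu c t.*2.+2) /\ growth (fun i => 'C(i + t.+1, t.+1)) t.+1 (mu c t.*2.+3).
Proof.
elim: t => [|t [IHe IHo]]; last rewrite doubleS.
  split=> q.
    have [C hC] := poly_le_exp q; exists (c * q + 3 * q + C) => i.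
    rewrite muln0 add0n expn1; apply: (@leq_trans ((2 ^ (c + 3) * i.+1) ^ q)).
      case: q {hC} => // q; rewrite leq_exp2r //; apply: leq_trans (mu2_le c i) _.
      by rewrite expnD; have := expn_gt0 2 c; nia.
    rewrite expnMn -expnM -!mulnDl; apply: leq_trans (leq_mul (leqnn _) (hC i)) _.
    by rewrite -expnD leq_pexp2l //; lia.
  exists ((c + 7) * q) => i; apply: (@leq_trans ((2 ^ (c + 7 + i)) ^ q)).
    case: q => // q; rewrite leq_exp2r //.
    have := mu3_le c i; rewrite expnD => h.
    apply: (@leq_trans ((2 ^ c * 3 + 32) * 2 ^ i)).
      by apply: leq_trans h; rewrite -!addnA leq_addr.
    by rewrite leq_mul2r expnD; have := expn_gt0 2 c; lia.
  by rewrite -expnM leq_pexp2l // bin1; lia.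
have small_o : growth (fun=> 0) t.+2 (mu c t.*2.+3) by apply: growth_absorb IHo => i; exact: bin_le_exp.
have small_e : growth (fun=> 0) t.+2 (mu c t.*2.+2) by apply: growth_absorb IHe => i.
have E : growth (fun=> 0) t.+2 (mu c t.*2.+4).
  pose b i := mu c t.*2.+3 i + mu c t.*2.+3 i + (mu c t.*2.+2 i + 2 ^ c).
  apply: growth_mono (growth_rec (b := b) (e := fun=> 0) (ltn0Sn t) (mu_gt0 c t.*2.+2) _ _ IHe _).
  - by move=> i; rewrite big1.
  - by rewrite /b /=; lia.
  - by move=> i; rewrite mu_rec /b mulnS; lia.
  - by do !apply: growthD => //; exact: growth_cst.
split; first exact: E.
pose b i := mu c t.*2.+4 i + mu c t.*2.+4 i + (mu c t.*2.+3 i + 2 ^ c).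
apply: growth_mono (growth_rec (b := b) (ltn0Sn t) (mu_gt0 c t.*2.+3) _ _ IHo _).
- by move=> i; exact: sum_bin.
- by rewrite /b /=; lia.
- by move=> i; rewrite mu_rec /b mulnS; lia.
- by do !apply: growthD => //; exact: growth_cst.
Qed.
(** * Block sequences of even order *)

Section Runs.
Variables (a b : nat).
Implicit Types (st : bool) (w u v : seq nat).

(* Number of maximal runs of [b] in the subsequence of [w] on the letters [a]
   and [b]; [st] tells whether a run of [b] is already open. *)
Fixpoint runs st w : nat :=
  if w is x :: w' then
    if x == b then ~~ st + runs true w' else runs (if x == a then false else st) w'
  else 0.

Fixpoint in_run st w : bool :=
  if w is x :: w' then in_run (if x == b then true else if x == a then false else st) w'
  else st.

Lemma runs_cat st u v : runs st (u ++ v) = runs st u + runs (in_run st u) v.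
Proof. by elim: u st => //= x u IHu st; case: ifP => _; rewrite IHu ?addnA. Qed.

Lemma in_run_cat st u v : in_run st (u ++ v) = in_run (in_run st u) v.
Proof. by elim: u st => /=. Qed.

Lemma runs_filter (p : pred nat) st w : p a -> p b ->
  runs st (filter p w) = runs st w.
Proof.
move=> pa pb; elim: w st => //= x w IHw st; case: ifP => px /=; rewrite !IHw //.
by case: eqP => [xb|_]; [rewrite -xb px in pb|case: eqP => // xa; rewrite -xa px in pa].
Qed.

Lemma runs_open w : runs true w <= runs false w.
Proof.
elim: w => //= x w IHw; case: ifP => _; first by rewrite leq_addl.
by case: ifP.
Qed.

Lemma runs_notin st w : b \notin w -> runs st w = 0.
Proof.
elim: w st => //= x w IHw st; rewrite inE negb_or eq_sym => /andP[/negbTE-> bw].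
exact: IHw.
Qed.

Lemma in_run_notin st w : b \notin w -> in_run st w = st && (a \notin w).
Proof.
elim: w st => [|x w IHw] st /=; first by rewrite andbT.
rewrite !inE negb_or eq_sym => /andP[/negbTE-> bw]; rewrite IHw // (eq_sym a).
by case: (x == a); rewrite //= andbF.
Qed.

Lemma runs_notin_sep st w : a \notin w -> runs st w = ~~ st && (b \in w).
Proof.
elim: w st => [|x w IHw] st /=; first by rewrite andbF.
rewrite !inE negb_or eq_sym => /andP[/negbTE-> aw]; rewrite (eq_sym b).
by case: eqP => _ /=; rewrite IHw //= addn0 andbT.
Qed.

Lemma in_run_notin_sep st w : a \notin w -> in_run st w = st || (b \in w).
Proof.
elim: w st => [|x w IHw] st /=; first by rewrite orbF.
rewrite !inE negb_or eq_sym => /andP[/negbTE-> aw]; rewrite IHw // (eq_sym b).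
by case: eqP => _ //=; rewrite orbT.
Qed.

Lemma runs_count st w : runs st w <= ~~ st + count_mem a w.
Proof.
elim: w st => //= x w IHw st; have [xb|_] := eqVneq x b.
  by have := IHw true; lia.
have := IHw st; have := IHw false; case: eqP => _ /=; lia.
Qed.

Lemma in_run_filter (p : pred nat) st w : p a -> p b ->
  in_run st (filter p w) = in_run st w.
Proof.
move=> pa pb; elim: w st => //= x w IHw st; case: ifP => px /=; rewrite !IHw //.
by case: eqP => [xb|_]; [rewrite -xb px in pb|case: eqP => // xa; rewrite -xa px in pa].
Qed.

Lemma runs_count_mem st w : runs st w <= count_mem b w.
Proof.
elim: w st => //= x w IHw st; case: (x == b) => /=; last exact: IHw.
by have := IHw true; case: st => /=; lia.
Qed.

(** A block lacking one of the two letters affects the runs only through its set of letters, so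
    repeating or permuting them changes nothing. *)
Lemma runs_expand (I : eqType) (f g : I -> seq nat) (S : seq I) st :
  {in S, forall i, g i = f i \/ g i =i f i /\ (a \notin f i) || (b \notin f i)} ->
  runs st (flatten (map g S)) = runs st (flatten (map f S))
  /\ in_run st (flatten (map g S)) = in_run st (flatten (map f S)).
Proof.
elim: S st => //= X S IHS st gS.
have [r s] : runs st (g X) = runs st (f X) /\ in_run st (g X) = in_run st (f X).
  have [->//|[gX /orP[nX|nX]]] := gS X (mem_head X S).
    by rewrite !runs_notin_sep ?in_run_notin_sep ?gX.
  by rewrite !runs_notin ?in_run_notin ?gX.
rewrite !runs_cat !in_run_cat r s.
by case: (IHS (in_run st (f X))) => [Y YS|-> ->] //; apply: gS; rewrite inE YS orbT.
Qed.

(** On the two letters w reads a* b*, so its only possible run is still open at the end and can be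
    continued by what follows. *)
Lemma runs_before w : ~~ subseq [:: b; a] w -> runs false w <= in_run false w.
Proof.
elim: w => // x w IHw /=; rewrite eq_sym; case: eqP => [_|_].
  by rewrite sub1seq => aw; rewrite runs_notin_sep // in_run_notin_sep.
by move/IHw; case: ifP.
Qed.

Hypothesis ab : a != b.

Lemma runs_after st w : ~~ subseq [:: a; b] w -> runs st w <= ~~ st.
Proof.
elim: w st => // x w IHw st /=; have [->|xb] := eqVneq x b.
  by rewrite (negbTE ab) => /(IHw true); lia.
rewrite eq_sym; case: eqP => [_|_]; last exact: IHw.
by rewrite sub1seq => bw; rewrite runs_notin.
Qed.
End Runs.

(* Opening a run of [a] closes a run of [b] and conversely. *)
Lemma runs_swap a b st w : a != b ->
  runs a b st w + ~~ in_run a b st w = runs b a (~~ st) w + ~~ st.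
Proof.
move=> ab; elim: w st => [|x w IHw] st /=; first by case: st.
have [->|xb] := eqVneq x b; first by have := IHw true; rewrite eq_sym (negbTE ab) /=; lia.
have [_|_] := eqVneq x a; last exact: IHw.
by have := IHw false => /=; case: st => /=; lia.
Qed.

(** The ends read a* b* and b* a*, so only the letters a of [M] can separate runs of b: there is at
    most one more run of b than runs of a in [M]. The exchange of roles is what the reversal in
    [relabel] compensates. *)
Lemma runs_sandwich a b L M R : a != b ->
  ~~ subseq [:: b; a] L -> ~~ subseq [:: a; b] R ->
  runs a b false (L ++ M ++ R) <= (runs b a false M).+1.
Proof.
move=> ab nL nR; rewrite !runs_cat.
have := runs_before nL; have := runs_swap (in_run a b false L) M ab.
have := @runs_after a b ab (in_run a b (in_run a b false L) M) R nR.
have := runs_open b a M; case: (in_run a b false L) => /=; lia.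
Qed.

Lemma runs_map (f : nat -> nat) a b st w :
  {in w, forall x, (f x == f a) = (x == a)} -> {in w, forall x, (f x == f b) = (x == b)} ->
  runs (f a) (f b) st (map f w) = runs a b st w.
Proof.
elim: w st => //= x w IHw st fa fb; rewrite fa ?fb ?mem_head //.
have fa' : {in w, forall x, (f x == f a) = (x == a)} by move=> y yw; rewrite fa // inE yw orbT.
have fb' : {in w, forall x, (f x == f b) = (x == b)} by move=> y yw; rewrite fb // inE yw orbT.
by rewrite !IHw.
Qed.

Lemma subseq2_cat (x y : nat) u v : x \notin u -> y \notin v -> ~~ subseq [:: x; y] (u ++ v).
Proof.
elim: u => [|z u IHu] xu yv.
  by apply: contra yv => /mem_subseq; apply; rewrite !inE eqxx orbT.
by move: xu; rewrite inE negb_or /= => /andP[/negbTE-> xu]; exact: IHu.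
Qed.

Lemma subseq2_catr (x y : nat) u v : x \notin u -> subseq [:: x; y] (u ++ v) -> subseq [:: x; y] v.
Proof. by elim: u => //= z u IHu; rewrite inE negb_or => /andP[/negbTE-> /IHu]. Qed.

Lemma subseq2_catl (x y : nat) u v : y \notin v -> subseq [:: x; y] (u ++ v) -> subseq [:: x; y] u.
Proof.
move=> yv; elim: u => [|z u IHu] /=.
  by move/mem_subseq/(_ y); rewrite !inE eqxx orbT (negbTE yv) => /(_ isT).
by case: eqP => _; [rewrite !sub1seq mem_cat (negbTE yv) orbF|].
Qed.

(* A block sequence on the symbols below [N], of average multiplicity [mu].
   Alternation is measured asymmetrically: only the runs of the larger of two
   symbols count. *)
Record inner h mu k B N (S : seq (seq nat)) : Prop := Inner {
  inner_size : size S = B;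
  inner_block : {in S, forall X, [/\ size X = k, uniq X & {in X, forall x, x < N}]};
  inner_cover : forall x, x < N -> x \in flatten S;
  inner_card : N * mu = B * k;
  inner_runs : forall a b, a < b -> b < N -> runs a b false (flatten S) <= h }.

(* Two symbols [a < b] share at most one block [X]; if they do, the sequence
   restricted to them is a* b* (ab) b* a*. *)
Record outer h mu k B N (S : seq (seq nat)) : Prop := Outer {
  outer_inner : inner h mu k B N S;
  outer_sorted : {in S, forall X, sorted ltn X};
  outer_shared : forall L X R a b, S = L ++ X :: R -> a < b -> a \in X -> b \in X ->
    [/\ ~~ subseq [:: b; a] (flatten L), ~~ subseq [:: a; b] (flatten R)
      & {in L ++ R, forall Y, (a \notin Y) || (b \notin Y)}] }.

(* The reversal lets the larger symbol of a block play the part of the smaller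
   one in [M]. As it is next to the block in a* b* (ab) b* a*, substituting [M]
   then adds only one run. *)
Definition relabel (M : seq (seq nat)) (X : seq nat) := [seq [seq nth 0 (rev X) p | p <- Y] | Y <- M].
Definition subst_blocks (S M : seq (seq nat)) := flatten (map (relabel M) S).

Lemma flatten_subst S M :
  flatten (subst_blocks S M) = flatten [seq map (nth 0 (rev X)) (flatten M) | X <- S].
Proof.
by rewrite /subst_blocks; elim: S => //= X S IHS; rewrite flatten_cat IHS map_flatten.
Qed.

Section Subst.
Variables (h mt mm l k Bt Bm Nt : nat) (S M : seq (seq nat)).
Hypothesis (HS : outer h.+1 mt l Bt Nt S) (HM : inner h mm k Bm l M).

Let g X := map (nth 0 (rev X)) (flatten M).

Lemma mem_relabel X : X \in S -> g X =i X.
Proof.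
move=> XS x; have [sX uX _] := inner_block (outer_inner HS) XS.
apply/mapP/idP => [[p /flattenP[Y YM pY] ->]|xX].
  have [_ _ Yl] := inner_block HM YM.
  by rewrite -mem_rev mem_nth // size_rev sX Yl.
exists (index x (rev X)); last by rewrite nth_index // mem_rev.
by apply: (inner_cover HM); rewrite -sX -size_rev index_mem mem_rev.
Qed.

(** Symbols without a common block are covered by [runs_expand]. If they share X, they meet nowhere
    else, and [runs_sandwich] reduces to the runs of the smaller symbol inside the image of X; after
    the reversal it plays the larger symbol of [M], so these are at most h. *)
Lemma inner_subst : inner h.+1 (mt * mm) k (Bt * Bm) Nt (subst_blocks S M).
Proof.
have [[sS bS cS nS rS] oS dS] := HS; have [sM bM cM nM rM] := HM.
split.
- rewrite /subst_blocks -sS -sM.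
  by elim: (S) => //= X S' IHS; rewrite size_cat IHS size_map mulSn.
- move=> Z /flattenP[_ /mapP[X XS ->] /mapP[Y YM ->]].
  have [sX uX lX] := bS X XS; have [sY uY lY] := bM Y YM.
  split; first by rewrite size_map.
    rewrite map_inj_in_uniq // => p q /lY pl /lY ql /eqP.
    by rewrite nth_uniq ?rev_uniq ?size_rev ?sX // => /eqP.
  by move=> _ /mapP[p /lY pl ->]; apply: lX; rewrite -mem_rev mem_nth // size_rev sX.
- move=> x /cS/flattenP[X XS xX]; rewrite flatten_subst; apply/flattenP.
  by exists (g X); [exact: map_f|rewrite mem_relabel].
- by rewrite mulnA nS -mulnA nM mulnA.
- move=> a b ab bN; rewrite flatten_subst -/g.
  have [/hasP[X XS /andP[aX bX]]|/hasPn nsh] := boolP (has (fun X => (a \in X) && (b \in X)) S); last first.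
    have [X XS|-> _] := @runs_expand a b _ id g S false; last by rewrite map_id; exact: rS.
    by right; rewrite -negb_and nsh //; split=> //; exact: mem_relabel.
  have [L [R SE]] : exists L R, S = L ++ X :: R by case/splitPr: XS => L R; exists L, R.
  have [nL nR nLR] := dS _ _ _ _ _ SE ab aX bX.
  have XS' : {subset L ++ R <= S} by move=> Y; rewrite SE !mem_cat inE => /orP[->|->]; rewrite ?orbT.
  have ex V st : {subset V <= L ++ R} -> runs a b st (flatten (map g V)) = runs a b st (flatten V)
      /\ in_run a b st (flatten (map g V)) = in_run a b st (flatten V).
    move=> VS; have := @runs_expand a b _ id g V st; rewrite map_id; apply=> Y /VS YL.
    by right; split; [exact/mem_relabel/XS'|exact: nLR].
  have exL := ex L false (ltac:(by move=> Y YL; rewrite mem_cat YL)).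
  have exR st := ex R st (ltac:(by move=> Y YR; rewrite mem_cat YR orbT)).
  have abn : a != b by rewrite neq_ltn ab.
  rewrite SE map_cat /= flatten_cat /= !runs_cat; have [-> ->] := exL; have [-> _] := exR (in_run a b (in_run a b false (flatten L)) (g X)).
  rewrite -!runs_cat; apply: leq_trans (runs_sandwich (g X) abn nL nR) _; rewrite ltnS.
  have [sX uX lX] := bS X XS.
  have [rX lM] : sorted gtn (rev X) /\ forall p, p \in flatten M -> p < size (rev X).
    rewrite rev_sorted size_rev sX; split; first exact: oS.
    by move=> p /flattenP[Y /bM[_ _]]; apply.
  have [aX' bX' uX'] : [/\ a \in rev X, b \in rev X & uniq (rev X)] by rewrite !mem_rev rev_uniq.
  rewrite -{1}(nth_index 0 bX') -{1}(nth_index 0 aX').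
  have nthE y : y \in rev X -> {in flatten M, forall p,
      (nth 0 (rev X) p == nth 0 (rev X) (index y (rev X))) = (p == index y (rev X))}.
    by move=> yX p /lM pl; rewrite nth_uniq // index_mem.
  rewrite runs_map; [|exact: nthE..].
  apply: rM; last by rewrite -sX -size_rev index_mem.
  rewrite ltnNge leq_eqVlt negb_or; apply/andP; split.
    by apply: contra abn => /eqP e; rewrite -(nth_index 0 aX') e nth_index.
  apply/negP => lt_ab; have := @sorted_ltn_nth _ gtn (fun y x z xy yz => ltn_trans yz xy) 0 _ rX.
  move=> /(_ (index a (rev X)) (index b (rev X))); rewrite !inE !index_mem aX' bX' => /(_ isT isT lt_ab).
  by rewrite !nth_index //= ltnNge (ltnW ab).
Qed.

End Subst.

(** * Shuffling into copies with shorter blocks *)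

Lemma cat_split_cons (T : Type) (u v L R : seq T) B : u ++ v = L ++ B :: R ->
  (exists2 R', u = L ++ B :: R' & R = R' ++ v) \/
  (exists2 L', L = u ++ L' & v = L' ++ B :: R).
Proof.
elim: u L => [|x u IHu] L; first by move=> /= ->; right; exists L.
case: L => [|y L] /= [<-].
  by move=> <-; left; exists u.
move/IHu => [[R' -> ->]|[L' -> ->]]; first by left; exists R'.
by right; exists L'.
Qed.

Lemma mem_zip (T1 T2 : eqType) (X : seq T1) (W : seq T2) x y :
  (x, y) \in zip X W -> (x \in X) && (y \in W).
Proof.
elim: X W => [|x' X IHX] [|y' W] //; rewrite /= !inE xpair_eqE.
by case/orP => [/andP[-> ->]//|/IHX/andP[-> ->]]; rewrite !orbT.
Qed.

Section Shuffle.
Variables (Nt Nb : nat) (bot : seq (seq nat)).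

Definition copy_symbol c u := Nt + c * Nb + u.
Definition insert c (X : seq nat) (W : seq (seq nat)) := [seq gY.1 :: map (copy_symbol c) gY.2 | gY <- zip X W].

(* Copy number [c] of [bot] uses the symbols [Nt + c * Nb + u]; its [i]-th block
   receives the [i]-th symbol of the [c]-th block of [S]. *)
Fixpoint shuffle c (S : seq (seq nat)) :=
  if S is X :: S' then insert c X bot ++ shuffle c.+1 S' else [::].

Lemma shuffle_cat c S S' : shuffle c (S ++ S') = shuffle c S ++ shuffle (c + size S) S'.
Proof. by elim: S c => [|X S IHS] c /=; rewrite ?addn0 // IHS catA addnS addSn. Qed.

Lemma mem_insert c X W x : size X = size W ->
  (x \in flatten (insert c X W)) = (x \in X) || (x \in map (copy_symbol c) (flatten W)).
Proof.
rewrite /insert; elim: W X => [|Y W IHW] [|g X] //= [/IHW{}IHW].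
rewrite map_cat !inE !mem_cat IHW -!orbA; congr (_ || _).
by rewrite orbCA.
Qed.

Lemma count_insert c X W x : x < Nt -> size X = size W ->
  count_mem x (flatten (insert c X W)) = count_mem x X.
Proof.
move=> xN; rewrite /insert; elim: W X => [|Y W IHW] [|g X] //= [/IHW{}IHW].
rewrite count_cat IHW; congr (_ + _); rewrite -[RHS]add0n; congr (_ + _).
by apply/count_memPn/mapP => -[y _]; rewrite /copy_symbol; lia.
Qed.

Lemma filter_insert_lt c X W : size X = size W -> {in X, forall x, x < Nt} ->
  filter (fun x => x < Nt) (flatten (insert c X W)) = X.
Proof.
rewrite /insert; elim: W X => [|Y W IHW] [|g X] //= [sX] XN.
rewrite filter_cat XN ?mem_head //= (IHW X) // => [|x xX]; last by rewrite XN // inE xX orbT.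
rewrite (eq_in_filter (a2 := pred0)) ?filter_pred0 // => _ /mapP[y _ ->].
by apply/negbTE; rewrite /copy_symbol -leqNgt -addnA leq_addr.
Qed.

Lemma filter_insert_ge c X W : size X = size W -> {in X, forall x, x < Nt} ->
  filter (fun x => Nt <= x) (flatten (insert c X W)) = map (copy_symbol c) (flatten W).
Proof.
rewrite /insert; elim: W X => [|Y W IHW] [|g X] //= [sX] XN.
rewrite filter_cat leqNgt XN ?mem_head //= (IHW X) // => [|x xX]; last by rewrite XN // inE xX orbT.
rewrite (eq_in_filter (a2 := predT)) ?filter_predT ?map_cat // => _ /mapP[y _ ->].
by rewrite /copy_symbol -addnA leq_addr.
Qed.

Lemma copy_symbolK c : cancel (copy_symbol c) (subn^~ (Nt + c * Nb)).
Proof. by move=> u; rewrite /copy_symbol addKn. Qed.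

Section Facts.
Variables (h mu k j C : nat) (S0 : seq (seq nat)).
Hypothesis h2 : 1 < h.
Hypothesis (HS : inner h mu k C Nt S0) (Hb : outer h mu j k Nb bot).

Let blockP X : X \in S0 -> [/\ size X = size bot, uniq X & {in X, forall x, x < Nt}].
Proof. by case/(inner_block HS) => sX uX XN; rewrite (inner_size (outer_inner Hb)) sX. Qed.

Let botN x : x \in flatten bot -> x < Nb.
Proof. by case/flattenP => Y /(inner_block (outer_inner Hb))[_ _]; apply. Qed.

Lemma mem_shuffle c S x : {subset S <= S0} -> x \in flatten (shuffle c S) ->
  x < Nt \/ Nt + c * Nb <= x < Nt + (c + size S) * Nb.
Proof.
elim: S c => //= X S IHS c SS; have [sX uX XN] := blockP (SS X (mem_head _ _)).
rewrite flatten_cat mem_cat mem_insert // => /orP[/orP[/XN|/mapP[y /botN yN ->]]|].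
- by left.
- by right; rewrite /copy_symbol; nia.
have {}SS : {subset S <= S0} by move=> Y YS; apply: SS; rewrite inE YS orbT.
by case/(IHS c.+1 SS) => ?; [left|right; nia].
Qed.

Lemma notin_shuffle c c' S y : {subset S <= S0} -> y < Nb ->
  (c' < c) || (c + size S <= c') -> copy_symbol c' y \notin flatten (shuffle c S).
Proof.
by move=> SS yN cc; apply/negP => /(mem_shuffle SS); rewrite /copy_symbol; case=> [|]; nia.
Qed.

Lemma filter_shuffle c S : {subset S <= S0} ->
  filter (fun x => x < Nt) (flatten (shuffle c S)) = flatten S.
Proof.
elim: S c => //= X S IHS c SS; have [sX uX XN] := blockP (SS X (mem_head _ _)).
rewrite flatten_cat filter_cat filter_insert_lt // IHS // => Y YS.
by apply: SS; rewrite inE YS orbT.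
Qed.

Lemma shuffle_block c S Z : Z \in shuffle c S ->
  exists c' g Y, [/\ c <= c' < c + size S, g \in flatten S, Y \in bot & Z = g :: map (copy_symbol c') Y].
Proof.
elim: S c => //= X S IHS c; rewrite mem_cat => /orP[/mapP[[g Y] /mem_zip/andP[gX YW] ->]|].
  by exists c, g, Y; split; rewrite ?mem_cat ?gX //; lia.
move=> /IHS[c' [g [Y [cc gS YW ->]]]]; exists c', g, Y; split=> //; first by lia.
by rewrite mem_cat gS orbT.
Qed.

Lemma size_shuffle c S : {subset S <= S0} -> size (shuffle c S) = size S * size bot.
Proof.
elim: S c => //= X S IHS c SS; have [sX _ _] := blockP (SS X (mem_head _ _)).
rewrite size_cat size_map size_zip sX minnn IHS // => Y YS.
by apply: SS; rewrite inE YS orbT.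
Qed.

Let local_copy y : Nt <= y < Nt + C * Nb -> exists c v S1 X S2,
  [/\ y = copy_symbol c v, v < Nb, S0 = S1 ++ X :: S2 & size S1 = c].
Proof.
move=> yP; have Nb0 : 0 < Nb by case: (Nb) yP => //; lia.
pose c := (y - Nt) %/ Nb; pose v := (y - Nt) %% Nb.
have cC : c < size S0 by rewrite (inner_size HS) ltn_divLR //; lia.
exists c, v, (take c S0), (nth [::] S0 c), (drop c.+1 S0); split.
- by rewrite /copy_symbol -addnA -divn_eq; lia.
- by rewrite ltn_mod.
- by rewrite -drop_nth // cat_take_drop.
- by rewrite size_take cC.
Qed.

(** Local symbols are numbered above the global ones, so in a mixed pair only the runs of the local
    symbol count: the global one occurs at most once within that copy and leaves at most two runs,
    whence [1 < h]. Local symbols of different copies do not interleave; the remaining pairs inherit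
    the bound from [S0] or [bot]. *)
Lemma runs_shuffle a b : a < b -> b < Nt + C * Nb -> runs a b false (flatten (shuffle 0 S0)) <= h.
Proof.
move=> ab bN; have [bNt|Ntb] := ltnP b Nt.
  rewrite -(@runs_filter _ _ (fun x => x < Nt)) //; last exact: ltn_trans bNt.
  by rewrite filter_shuffle //; exact: (inner_runs HS).
have [c [v [S1 [X [S2 [bE vN SE S1c]]]]]] := @local_copy b ltac:(by rewrite Ntb).
have SS1 : {subset S1 <= S0} by move=> Y Y1; rewrite SE mem_cat Y1.
have SS2 : {subset S2 <= S0} by move=> Y Y2; rewrite SE mem_cat inE Y2 !orbT.
have [sX uX XN] := blockP (ltac:(by rewrite SE mem_cat mem_head orbT) : X \in S0).
have n1 u : u < Nb -> copy_symbol c u \notin flatten (shuffle 0 S1).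
  by move=> uN; apply: notin_shuffle => //; rewrite add0n S1c leqnn orbT.
have n2 u : u < Nb -> copy_symbol c u \notin flatten (shuffle c.+1 S2).
  by move=> uN; apply: notin_shuffle => //; rewrite ltnSn.
rewrite SE shuffle_cat /= !flatten_cat !runs_cat add0n S1c.
rewrite bE in ab *; rewrite (runs_notin _ _ (n1 _ vN)) (runs_notin _ _ (n2 _ vN)) in_run_notin ?n1 //= add0n addn0.
have [aNt|Nta] := ltnP a Nt.
  apply: leq_trans (runs_count _ _ _ _) _; rewrite count_insert // count_uniq_mem //.
  by apply: leq_trans h2; case: (a \in X).
have aN : a < Nt + C * Nb by apply: ltn_trans bN; rewrite bE.
have [c' [u [_ [_ [_ [aE uN _ _]]]]]] := @local_copy a ltac:(by rewrite Nta).
rewrite aE in ab *; have [cc|cc|cc] := ltngtP c' c.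
- rewrite runs_notin_sep; first exact: leq_trans (leq_b1 _) (ltnW h2).
  rewrite mem_insert // negb_or; apply/andP; split.
    by apply/negP => /XN; rewrite /copy_symbol; lia.
  by apply/mapP => -[z /botN zN]; rewrite /copy_symbol; nia.
- by move: ab; rewrite /copy_symbol; nia.
rewrite cc in ab *; rewrite -(@runs_filter _ _ (fun x => Nt <= x)) /=; last 2 first.
- by rewrite /copy_symbol -addnA leq_addr.
- by rewrite /copy_symbol -addnA leq_addr.
rewrite filter_insert_ge // runs_map => [|x _|x _]; last 2 first.
- by rewrite (can_eq (copy_symbolK _)).
- by rewrite (can_eq (copy_symbolK _)).
by apply: (inner_runs (outer_inner Hb)); rewrite // /copy_symbol ltn_add2l in ab.
Qed.

Lemma inner_shuffle : inner h mu j.+1 (C * k) (Nt + C * Nb) (shuffle 0 S0).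
Proof.
split.
- by rewrite size_shuffle // (inner_size HS) (inner_size (outer_inner Hb)).
- move=> Z /shuffle_block[c [g [Y [cc gS YW ->]]]].
  have [sY uY YN] := inner_block (outer_inner Hb) YW.
  have gN : g < Nt by case/flattenP: gS => X /(inner_block HS)[_ _]; apply.
  split; first by rewrite /= size_map sY.
    rewrite /= map_inj_uniq ?uY ?andbT; last exact: can_inj (copy_symbolK _).
    by apply/mapP => -[z _]; rewrite /copy_symbol; lia.
  move=> x; rewrite inE => /predU1P[->|/mapP[y /YN yN ->]]; first by lia.
  by have := inner_size HS; rewrite /copy_symbol; nia.
- move=> x xN; have [xNt|Nx] := ltnP x Nt.
    have := inner_cover HS xNt; rewrite -(filter_shuffle 0 (S := S0)) //.
    by rewrite mem_filter => /andP[].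
  have [c [v [S1 [X [S2 [-> vN SE S1c]]]]]] := @local_copy x ltac:(by rewrite Nx).
  have [sX uX XN] := blockP (ltac:(by rewrite SE mem_cat mem_head orbT) : X \in S0).
  rewrite SE shuffle_cat /= !flatten_cat !mem_cat add0n S1c mem_insert //.
  by rewrite map_f ?orbT //; exact: (inner_cover (outer_inner Hb)).
- rewrite mulnDl (inner_card HS) -mulnA (inner_card (outer_inner Hb)) mulnS.
  by rewrite mulnA.
- exact: runs_shuffle.
Qed.

Lemma shuffle_split c S L Z R : shuffle c S = L ++ Z :: R ->
  exists S1 X S2 L' R', [/\ S = S1 ++ X :: S2, insert (c + size S1) X bot = L' ++ Z :: R',
    L = shuffle c S1 ++ L' & R = R' ++ shuffle (c + size S1).+1 S2].
Proof.
elim: S c L => [|X S IHS] c L /=; first by case: L.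
move=> SE; case: (cat_split_cons SE) => [[R' iE ->]|[L' -> /IHS[S1 [X' [S2 [L2 [R' [-> iE -> ->]]]]]]]].
  by exists [::], X, S, L, R'; rewrite addn0.
by exists (X :: S1), X', S2, L2, R'; rewrite /= addnS -addSn catA.
Qed.

Lemma insert_split c X W L Z R : size X = size W -> insert c X W = L ++ Z :: R ->
  exists X1 g X2 W1 Y W2, [/\ X = X1 ++ g :: X2, W = W1 ++ Y :: W2, Z = g :: map (copy_symbol c) Y &
    [/\ size X1 = size W1, size X2 = size W2, L = insert c X1 W1 & R = insert c X2 W2]].
Proof.
rewrite /insert; elim: W X L => [|Y W IHW] [|g X] [|Z' L] //= [sX].
  by case=> <- <-; exists [::], g, X, [::], Y, W.
case=> <- /(IHW X L sX)[X1 [g' [X2 [W1 [Y' [W2 [-> -> -> [s1 s2 -> ->]]]]]]]].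
by exists (g :: X1), g', X2, (Y :: W1), Y', W2; rewrite /= s1.
Qed.

(** A block holds one global symbol g. A local v of that block is confined to its copy, where g
    occurs once, so together they read g* v* (g v) v* g*. Two local symbols inherit the property
    from [bot]. *)
Lemma outer_shuffle : outer h mu j.+1 (C * k) (Nt + C * Nb) (shuffle 0 S0).
Proof.
split; first exact: inner_shuffle.
  move=> Z /shuffle_block[c [g [Y [cc gS YW ->]]]].
  have gN : g < Nt by case/flattenP: gS => X /(inner_block HS)[_ _]; apply.
  rewrite /= path_sortedE; last exact: ltn_trans.
  apply/andP; split; first by apply/allP => _ /mapP[y _ ->]; rewrite /copy_symbol; lia.
  rewrite sorted_map; have := outer_sorted Hb YW; apply: sub_sorted => x y /=.
  by rewrite /copy_symbol; lia.
move=> L Z R a b SE ab aZ bZ.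
have [S1 [X [S2 [L1 [R1 [S0E iE -> ->]]]]]] := shuffle_split SE.
have [sX uX XN] := blockP (ltac:(by rewrite S0E mem_cat mem_head orbT) : X \in S0).
have [X1 [g [X2 [W1 [Y [W2 [XE botE ZE [s1 s2 L1E R1E]]]]]]]] := insert_split sX iE.
rewrite add0n in L1E R1E *; set c := size S1 in L1E R1E ZE *.
have SS1 : {subset S1 <= S0} by move=> V V1; rewrite S0E mem_cat V1.
have SS2 : {subset S2 <= S0} by move=> V V2; rewrite S0E mem_cat inE V2 !orbT.
have YN u : u \in Y -> u < Nb.
  by move=> uY; apply: botN; rewrite botE flatten_cat mem_cat /= mem_cat uY orbT.
have n1 u : u \in Y -> copy_symbol c u \notin flatten (shuffle 0 S1).
  by move=> /YN uN; apply: notin_shuffle => //; rewrite add0n leqnn orbT.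
have n2 u : u \in Y -> copy_symbol c u \notin flatten (shuffle c.+1 S2).
  by move=> /YN uN; apply: notin_shuffle => //; rewrite ltnSn.
have gN : g < Nt by apply: XN; rewrite XE mem_cat mem_head orbT.
have notin_blocks (V : seq (seq nat)) x W : x \notin flatten V -> W \in V -> x \notin W.
  by move=> xV WV; apply: contra xV => xW; apply/flattenP; exists W.
have [v vY bE] : exists2 v, v \in Y & b = copy_symbol c v.
  move: aZ bZ; rewrite ZE !inE => /predU1P[aE|/mapP[u _ aE]] /predU1P[bE|/mapP[v vY ->]].
  - by rewrite aE bE ltnn in ab.
  - by exists v.
  - by move: ab; rewrite aE bE /copy_symbol; lia.
  - by exists v.
rewrite bE in ab bZ *; move: aZ; rewrite ZE inE => /predU1P[aE|/mapP[u uY aE]]; rewrite aE in ab *.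
  have gX1 : g \notin flatten L1.
    rewrite L1E mem_insert // negb_or; apply/andP; split.
      by move: uX; rewrite XE cat_uniq /= negb_or => /and3P[_ /andP[]].
    by apply/mapP => -[z _]; rewrite /copy_symbol; lia.
  have gX2 : g \notin flatten R1.
    rewrite R1E mem_insert // negb_or; apply/andP; split.
      by move: uX; rewrite XE cat_uniq /= => /and3P[_ _ /andP[]].
    by apply/mapP => -[z _]; rewrite /copy_symbol; lia.
  split.
  - by rewrite flatten_cat subseq2_cat // n1.
  - by rewrite flatten_cat subseq2_cat // n2.
  - move=> V; rewrite !mem_cat => /orP[/orP[V1|V1]|/orP[V1|V1]].
    + by rewrite (notin_blocks _ _ _ (n1 _ vY) V1) orbT.
    + by rewrite (notin_blocks _ _ _ gX1 V1).
    + by rewrite (notin_blocks _ _ _ gX2 V1).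
    + by rewrite (notin_blocks _ _ _ (n2 _ vY) V1) orbT.
have uv : u < v by rewrite /copy_symbol ltn_add2l in ab.
have [nL nR nLR] := outer_shared Hb botE uv uY vY.
have XN1 : {in X1, forall x, x < Nt} by move=> x x1; apply: XN; rewrite XE mem_cat x1.
have XN2 : {in X2, forall x, x < Nt} by move=> x x2; apply: XN; rewrite XE mem_cat inE x2 !orbT.
have pull x y X' W' : size X' = size W' -> {in X', forall z, z < Nt} ->
    subseq [:: copy_symbol c x; copy_symbol c y] (flatten (insert c X' W')) -> subseq [:: x; y] (flatten W').
  move=> sX' XN' sub.
  have : subseq [:: copy_symbol c x; copy_symbol c y] (map (copy_symbol c) (flatten W')).
    rewrite -(filter_insert_ge c sX' XN') subseq_filter sub andbT /= !andbT.
    by rewrite /copy_symbol; lia.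
  by move/(map_subseq (subn^~ (Nt + c * Nb))); rewrite mapK /=; [rewrite !copy_symbolK|exact: copy_symbolK].
split.
- rewrite flatten_cat; apply/negP => /(subseq2_catr (n1 _ vY)); rewrite L1E => /pull.
  by move=> /(_ s1 XN1); apply/negP.
- rewrite flatten_cat; apply/negP => /(subseq2_catl (n2 _ vY)); rewrite R1E => /pull.
  by move=> /(_ s2 XN2); apply/negP.
- have blk V X' W' : V \in insert c X' W' -> size X' = size W' -> {in X', forall z, z < Nt} ->
      {subset W' <= W1 ++ W2} -> (copy_symbol c u \notin V) || (copy_symbol c v \notin V).
    move=> /mapP[[x W] /mem_zip/andP[xX WW] ->] _ XN' /(_ _ WW)/nLR.
    have xN : forall w, (copy_symbol c w == x) = false by move=> w; have := XN' _ xX; rewrite /copy_symbol; lia.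
    by rewrite !inE !xN /= !(mem_map (can_inj (copy_symbolK c))).
  move=> V; rewrite !mem_cat => /orP[/orP[V1|V1]|/orP[V1|V1]].
  + by rewrite (notin_blocks _ _ _ (n1 _ vY) V1) orbT.
  + by rewrite L1E in V1; apply: (blk _ _ _ V1) => // w w1; rewrite mem_cat w1.
  + by rewrite R1E in V1; apply: (blk _ _ _ V1) => // w w2; rewrite mem_cat w2 orbT.
  + by rewrite (notin_blocks _ _ _ (n2 _ vY) V1) orbT.
Qed.
End Facts.
End Shuffle.

(** * Block counts and existence for even orders *)

Lemma iter_ackD k m n : ack k.+1 (n + m) = iter n (ack k) (ack k.+1 m).
Proof. by rewrite /= iterD. Qed.

Lemma ack1E m : ack 1 m = 2 ^ m.
Proof. by elim: m => // m IHm; rewrite ack_rec IHm expnS mul2n. Qed.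

Lemma iter_ack_mul k x n c : c <= n -> 2 ^ c * x <= iter n (ack k) x.
Proof.
elim: n c => [|n IHn] c; first by rewrite leqn0 => /eqP->; rewrite mul1n.
case: c => [_|c cn]; last first.
  by rewrite expnS -mulnA mul2n (leq_trans _ (ack_double _ _)) // leq_double IHn.
by apply: leq_trans (IHn 0 isT) _; apply: leq_trans (ack_double _ _); rewrite -addnn leq_addr.
Qed.

Lemma leq_iter_ack k x m n : m <= n -> iter m (ack k) x <= iter n (ack k) x.
Proof.
by move=> /subnK <-; rewrite iterD -[leqLHS]mul1n -[1]/(2 ^ 0); exact: iter_ack_mul.
Qed.

Lemma sqr_le_ack k x : 0 < k -> 4 <= x -> x * x <= ack k x.
Proof.
move=> k0 x4; apply: leq_trans (leq_ack_lvl x k0); rewrite ack1E.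
rewrite -(subnK x4); elim: (x - 4) => // n IHn.
by rewrite addSn expnS; apply: leq_trans (leq_mul (leqnn 2) IHn); nia.
Qed.

(** In iterates of [ack K], passing from x to 16 * (x + 1) costs 5, applying [ack K] costs 1, and a
    product costs 1; two nested bounds and the products stay within 16. Hence the arguments
    [16 * j.+1]: raising j by one grants 16 iterations. *)
Lemma ack_block_bound K X k Bm l Bt : 0 < K -> 4 <= X -> k <= X ->
  Bm <= ack K (16 * k.+1) -> l <= Bm * k -> Bt <= ack K (16 * l.+1) ->
  Bt * Bm * k <= iter 16 (ack K) X.
Proof.
move=> K0 X4 kX BmE lE BtE.
have ge4 n : 4 <= iter n (ack K) X by apply: leq_trans X4 (@leq_iter_ack K X 0 n _).
have sqr n : iter n (ack K) X * iter n (ack K) X <= iter n.+1 (ack K) X by apply: sqr_le_ack.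
have step n x : x <= iter n (ack K) X -> ack K (16 * x.+1) <= iter (6 + n) (ack K) X.
  move=> xn; rewrite -[6 + n]/(5 + n).+1 iterS leq_ack // iterD.
  by apply: leq_trans (@iter_ack_mul _ _ 5 5 _) => //; have := ge4 n; lia.
have Bm6 : Bm <= iter 6 (ack K) X := leq_trans BmE (step 0 k kX).
have k6 : k <= iter 6 (ack K) X := leq_trans kX (@leq_iter_ack K X 0 6 isT).
have Bmk : Bm * k <= iter 7 (ack K) X := leq_trans (leq_mul Bm6 k6) (sqr 6).
have Bt13 : Bt <= iter 13 (ack K) X := leq_trans BtE (step 7 l (leq_trans lE Bmk)).
rewrite -mulnA; apply: leq_trans (leq_mul Bt13 (leq_trans Bmk (@leq_iter_ack K X 7 13 isT))) _.
by apply: leq_trans (sqr 13) _; apply: leq_iter_ack.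
Qed.

(** Three levels up, the value at 3 is [ack L.+1] at an argument of at least 16, which contains
    enough iterates of [ack L]. This brings block counts into the form used by [inv_ack], at the
    price of three levels. *)
Lemma ack_diag_bound L x : x <= ack L (ack L (16 * (ack L 32).+1)) -> x <= ack (L + 3) 3.
Proof.
move=> xL; have ack2 k : ack k 2 = 4 by elim: k => // k IHk; rewrite ack_rec ack1.
have ack3 k : ack k.+1 3 = ack k 4 by rewrite ack_rec ack2.
have -> : ack (L + 3) 3 = ack L.+1 (ack L.+1 4) by rewrite addn3 ack3 ack_rec ack3.
have h16 : 16 <= ack L.+1 4 by rewrite -[16]/(2 ^ 4) -ack1E leq_ack_lvl.
apply: leq_trans (leq_ack _ (leq_trans (leqnSn 15) h16)); rewrite (iter_ackD _ 5 10).
have h32 : 32 <= ack L.+1 5 by rewrite -[32]/(2 ^ 5) -ack1E leq_ack_lvl.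
apply: leq_trans xL _; apply: leq_trans (@leq_iter_ack _ _ 8 10 isT).
rewrite 2!iterS !leq_ack // -[6]/(5 + 1) iterD.
rewrite -[iter 1 _ _]/(ack L (ack L.+1 5)); apply: leq_trans (@iter_ack_mul _ _ 5 5 _) => //.
by have := leq_ack L h32; have := ack_double L 32; move: (ack L 32) (ack L (ack _ _)) => u v; rewrite -[2 ^ 5]/32; lia.
Qed.

(** Binary logarithm of the multiplicity at order t and level i: constantly 1 for t = 0, zero at i =
    0 for positive t, with leading term i^t / t!. *)
Definition lgmult t i := 'C((i + t).-1, t).

Lemma lgmult_rec t i : lgmult t.+1 i.+1 = lgmult t.+1 i + lgmult t i.+1.
Proof. by rewrite /lgmult !addnS !addSn /= binS. Qed.

Lemma subseq_sorted2 a b w : a < b -> sorted ltn w -> ~~ subseq [:: b; a] w.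
Proof.
move=> ab sw; apply/negP => /(subseq_sorted ltn_trans)/(_ sw) /=.
by rewrite ltnNge (ltnW ab).
Qed.

(** Any a < b reads a b b a. The pair shares two blocks, so the sequence is not of the kind
    [outer]. *)
Lemma inner_two k : inner 1 2 k 2 k [:: iota 0 k; rev (iota 0 k)].
Proof.
split=> //= [X|x xk||a b ab bk].
- rewrite !inE => /orP[] /eqP->; rewrite ?size_rev ?rev_uniq size_iota iota_uniq; split=> // x;
    by rewrite ?mem_rev mem_iota.
- by rewrite mem_cat mem_iota add0n xk.
- exact: mulnC.
- have abn : a != b by rewrite neq_ltn ab.
  rewrite cats0 -[rev _]cat0s; apply: (runs_sandwich [::] abn).
    by rewrite subseq_sorted2 // iota_ltn_sorted.
  rewrite -[[:: a; b]]/(rev [:: b; a]) subseq_rev.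
  by rewrite subseq_sorted2 // iota_ltn_sorted.
Qed.

Lemma outer_one h j : 0 < h -> outer h 1 j 1 j [:: iota 0 j].
Proof.
move=> h0; split=> [|X|[|? []] X R a b //= [<- <-]].
- split=> //= [X|x xj||a b ab bj]; first by rewrite inE => /eqP->; rewrite size_iota iota_uniq; split=> // x; rewrite mem_iota.
  + by rewrite cats0 mem_iota.
  + by rewrite muln1 mul1n.
  + apply: leq_trans h0; rewrite cats0 -[iota _ _]cats0 -[_ ++ [::]]/(iota 0 j ++ [::] ++ [::]).
    by apply: runs_sandwich; rewrite ?neq_ltn ?ab // subseq_sorted2 // iota_ltn_sorted.
- by rewrite inE => /eqP->; exact: iota_ltn_sorted.
- by [].
Qed.

Lemma outer_empty h mu : outer h mu 0 1 0 [:: [::]].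
Proof.
split=> [|X|[|? []] X R a b //= [<- <-]] //; last by rewrite inE => /eqP->.
by split=> //= X; rewrite inE => /eqP->.
Qed.

(** Induction on t, i and j. [bot] has the same order and level but blocks shorter by one. [M] has
    order t, level i + 1 and blocks as long as [bot] has blocks; [S] has order t + 1, level i and
    blocks as long as [M] has symbols. The logarithms of the multiplicities add by [lgmult_rec]. *)
Lemma exists_inner t i j : exists B N S,
  [/\ inner t.+1 (2 ^ lgmult t i) j B N S, 0 < t -> outer t.+1 (2 ^ lgmult t i) j B N S
    & 0 < B <= ack (i + t) (16 * j.+1)].
Proof.
have ack_gt0 k m : 0 < m -> 0 < ack k m by move=> m0; apply: leq_trans (ack_double _ _); rewrite double_gt0.
elim: t i j => [|t IHt] i j.
  exists 2, j, [:: iota 0 j; rev (iota 0 j)]; rewrite /lgmult bin0; split=> //.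
    exact: inner_two.
  by apply: leq_trans (ack_double _ _); rewrite -mul2n; lia.
elim: i j => [|i IHi] j.
  exists 1, j, [:: iota 0 j]; rewrite /lgmult add0n bin_small // expn0 ack_gt0 //.
  have H := outer_one j (ltn0Sn t.+1); by split=> //; exact: outer_inner H.
elim: j => [|j [k [Nb [bot [_ /(_ isT) Hbot /andP[k0 kX]]]]]].
  by exists 1, 0, [:: [::]]; have H := outer_empty t.+2 (2 ^ lgmult t.+1 i.+1); rewrite ack_gt0 //; split=> //; exact: outer_inner H.
have [Bm [l [M [HM _ /andP[Bm0 BmE]]]]] := IHt i.+1 k.
have [Bt [Nt [S [_ /(_ isT) HS /andP[Bt0 BtE]]]]] := IHi l.
have Hsub := inner_subst HS HM; rewrite -expnD -lgmult_rec in Hsub.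
have h2 : 1 < t.+2 by [].
have Hout := outer_shuffle h2 Hsub Hbot.
exists (Bt * Bm * k), (Nt + Bt * Bm * Nb), (shuffle Nt Nb bot 0 (subst_blocks S M)).
split=> //; first exact: outer_inner.
apply/andP; split; first by rewrite !muln_gt0 Bt0 Bm0 k0.
rewrite addSn mulnS iter_ackD.
 rewrite addSn in BmE; rewrite addSn addnS in kX; rewrite addnS in BtE *.
apply: (ack_block_bound (l := l)) kX BmE _ BtE => //.
  rewrite (leq_trans _ (ack_double _ _)) //; lia.
by rewrite -(inner_card HM) leq_pmulr // expn_gt0.
Qed.

(* Blocks as long as the multiplicity make the numbers of blocks and of symbols agree. *)
Lemma exists_outer t i : 0 < t -> exists N S,
  outer t.+1 (2 ^ lgmult t i) (2 ^ lgmult t i) N N S /\ 0 < N <= ack (i + t + 3) 3.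
Proof.
move=> t0; set mu := 2 ^ _; have mu0 : 0 < mu by rewrite expn_gt0.
have [B [N [S [_ /(_ t0) HS /andP[B0 BE]]]]] := exists_inner t i mu.
have [B1 [N1 [S1 [H1 _ /andP[B10 BE1]]]]] := exists_inner t i 1.
(* With blocks of length 1 the number of blocks is a positive multiple of the multiplicity. *)
have mu_le : mu <= ack (i + t) 32.
  apply: leq_trans BE1; rewrite -[B1]muln1 -(inner_card H1) leq_pmull //.
  by case: N1 H1 => // H1; have := inner_card H1; lia.
have NB : N = B.
  by have := inner_card (outer_inner HS) => /eqP; rewrite eqn_pmul2r // => /eqP.
exists B, S; rewrite -{2}NB; split=> //; rewrite B0; apply: ack_diag_bound.
apply: leq_trans BE _; apply: leq_trans (@leq_iter_ack _ _ 1 2 isT).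
by apply: leq_ack; lia.
Qed.
(** * Block sequences of order three *)

Lemma filter_pair (a b : nat) X : uniq X -> subseq [:: a; b] X ->
  filter (pred2 a b) X = [:: a; b].
Proof.
elim: X => // x X IHX /= /andP[xX uX]; rewrite eq_sym; case: eqP => [<-|xa].
  rewrite sub1seq /= => bX; rewrite (eq_in_filter (a2 := pred1 b)).
    by rewrite filter_pred1_uniq.
  by move=> y yX /=; case: eqP yX xX => // <- ->.
move=> sX; rewrite /= (IHX uX sX); case: eqP => // xb.
by rewrite xb (mem_subseq sX) // !inE eqxx orbT in xX.
Qed.

Lemma subseq_pair (a b : nat) X : a != b -> a \in X -> b \in X ->
  subseq [:: a; b] X || subseq [:: b; a] X.
Proof.
move=> ab; elim: X => // x X IHX; rewrite !inE /=.
case: (eqVneq a x) => [<-|_] /=; first by rewrite eq_sym (negbTE ab) /= !sub1seq => _ ->.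
case: (eqVneq b x) => _ /=; first by rewrite !sub1seq => ->; rewrite orbT.
exact: IHX.
Qed.

Definition words (Z : seq (bool * seq nat)) := flatten (unzip2 Z).
Definition special (Z : seq (bool * seq nat)) := count (fun e => e.1) Z.

Lemma words_cat Z1 Z2 : words (Z1 ++ Z2) = words Z1 ++ words Z2.
Proof. by rewrite /words /unzip2 map_cat flatten_cat. Qed.

Lemma words_cons e Z : words (e :: Z) = e.2 ++ words Z. Proof. by []. Qed.

Lemma special_cons e Z : special (e :: Z) = e.1 + special Z. Proof. by []. Qed.

Lemma special_cat Z1 Z2 : special (Z1 ++ Z2) = special Z1 + special Z2.
Proof. exact: count_cat. Qed.

Lemma mem_words (Z : seq (bool * seq nat)) e x : e \in Z -> x \in e.2 -> x \in words Z.
Proof. by move=> eZ xe; apply/flattenP; exists e.2 => //; exact: map_f. Qed.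

(* Special blocks are marked [true]; they hold the first occurrences. If [a] and
   [b] share one in this order, the sequence restricted to them is (ab) a* b*. *)
Record marked k j F D N (Z : seq (bool * seq nat)) : Prop := Marked {
  marked_special : special Z = F;
  marked_size : size Z = F + D;
  marked_block : {in Z, forall e, [/\ e.1 = true -> size e.2 = j, uniq e.2 & {in e.2, forall x, x < N}]};
  marked_card : N = F * j;
  marked_weight : size (words Z) = k.+1 * N;
  marked_runs : forall a b, a != b -> a < N -> b < N -> runs a b false (words Z) <= 2;
  marked_fresh : forall L X R a, Z = L ++ (true, X) :: R -> a \in X -> a \notin words L;
  marked_shared : forall L X R a b, Z = L ++ (true, X) :: R -> subseq [:: a; b] X ->
    ~~ subseq [:: b; a] (words R) }.

Section Refine.
Variables (Nt Nb : nat) (bot : seq (bool * seq nat)).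
Local Notation shift := (copy_symbol Nt Nb).

(** A global symbol is put at the end of a special block because its later occurrences follow all
    those of the local symbols, as [marked_shared] requires. The default of [head] is not reached
    when X has as many symbols as W has special blocks. *)
Fixpoint fill c X (W : seq (bool * seq nat)) :=
  if W is (sp, Y) :: W' then
    if sp then (true, rcons (map (shift c) Y) (head 0 X)) :: fill c (behead X) W'
    else (false, map (shift c) Y) :: fill c X W'
  else [::].

(** Only special blocks are shuffled into copies of [bot]. The reversed block after each copy gives
    its symbols one further occurrence, which raises their multiplicity to that of [bot]. *)
Fixpoint refine c Z :=
  if Z is (sp, X) :: Z' then
    if sp then fill c X bot ++ (false, rev X) :: refine c.+1 Z' else (false, X) :: refine c Z'
  else [::].

Lemma refine_cat c Z1 Z2 : refine c (Z1 ++ Z2) = refine c Z1 ++ refine (c + special Z1) Z2.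
Proof.
rewrite /special; elim: Z1 c => [|[[] X] Z IHZ] c /=; rewrite ?addn0 // IHZ //.
by rewrite -catA addnA addn1.
Qed.

Lemma mem_fill c X W x : size X = special W ->
  (x \in words (fill c X W)) = (x \in X) || (x \in map (shift c) (words W)).
Proof.
rewrite /words /special; elim: W X => [|[[] Y] W IHW] X /=; first by case: X.
  case: X => //= g X [sX]; rewrite map_cat !mem_cat mem_rcons !inE IHW // -!orbA.
  by congr (_ || _); rewrite orbCA.
by rewrite add0n => sX; rewrite map_cat !mem_cat IHW // orbCA.
Qed.

Lemma filter_fill_lt c X W : size X = special W -> {in X, forall x, x < Nt} ->
  filter (fun x => x < Nt) (words (fill c X W)) = X.
Proof.
have loc Y : filter (fun x => x < Nt) (map (shift c) Y) = [::].
  rewrite (eq_in_filter (a2 := pred0)) ?filter_pred0 // => _ /mapP[y _ ->].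
  by apply/negbTE; rewrite /copy_symbol -leqNgt -addnA leq_addr.
rewrite /words /special; elim: W X => [|[[] Y] W IHW] X /=; first by case: X.
  case: X => //= g X [sX] XN; rewrite filter_cat filter_rcons loc XN ?mem_head //= IHW // => x xX.
  by rewrite XN // inE xX orbT.
by rewrite add0n => sX XN; rewrite filter_cat loc IHW.
Qed.

Lemma filter_fill_ge c X W : size X = special W -> {in X, forall x, x < Nt} ->
  filter (fun x => Nt <= x) (words (fill c X W)) = map (shift c) (words W).
Proof.
have loc Y : filter (fun x => Nt <= x) (map (shift c) Y) = map (shift c) Y.
  rewrite (eq_in_filter (a2 := predT)) ?filter_predT // => _ /mapP[y _ ->].
  by rewrite /copy_symbol -addnA leq_addr.
rewrite /words /special; elim: W X => [|[[] Y] W IHW] X //=.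
  case: X => //= g X [sX] XN; rewrite filter_cat filter_rcons loc leqNgt XN ?mem_head //= map_cat IHW // => x xX.
  by rewrite XN // inE xX orbT.
by rewrite add0n => sX XN; rewrite filter_cat loc map_cat IHW.
Qed.

Lemma special_fill c X W : special (fill c X W) = special W.
Proof. by rewrite /special; elim: W X => [|[[] Y] W IHW] X //=; rewrite IHW. Qed.

Lemma size_fill c X W : size (fill c X W) = size W.
Proof. by elim: W X => [|[[] Y] W IHW] X //=; rewrite IHW. Qed.

Lemma size_words_fill c X W : size (words (fill c X W)) = special W + size (words W).
Proof.
rewrite /words /special; elim: W X => [|[[] Y] W IHW] X //=;
  by rewrite !size_cat ?size_rcons size_map IHW; lia.
Qed.

Lemma fill_block c X W e : size X = special W -> e \in fill c X W ->
  exists2 Y, (e.1, Y) \in W &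
    if e.1 then exists2 g, g \in X & e.2 = rcons (map (shift c) Y) g else e.2 = map (shift c) Y.
Proof.
rewrite /special; elim: W X => [|[[] Y] W IHW] X //=.
  case: X => // g X [sX]; rewrite inE => /predU1P[->|/(IHW X sX)[V VW]] /=.
    by exists Y; rewrite ?mem_head //; exists g; rewrite ?mem_head.
  move=> Ve; exists V; first by rewrite inE VW orbT.
  by case: (e.1) Ve => // -[x xX ->]; exists x; rewrite // inE xX orbT.
rewrite add0n inE => sX /predU1P[->|/(IHW X sX)[V VW]] /=; first by exists Y; rewrite ?mem_head.
by exists V; rewrite // inE VW orbT.
Qed.

Lemma fill_split c X W L V R : size X = special W -> fill c X W = L ++ (true, V) :: R ->
  exists X1 g X2 W1 Y W2,
  [/\ X = X1 ++ g :: X2, W = W1 ++ (true, Y) :: W2, V = rcons (map (shift c) Y) g &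
    [/\ size X1 = special W1, size X2 = special W2, L = fill c X1 W1 & R = fill c X2 W2]].
Proof.
rewrite /special; elim: W X L => [|[[] Y] W IHW] X [|e L] //=.
- case: X => //= g X [sX] [<- <-]; by exists [::], g, X, [::], Y, W.
- case: X => //= g X [sX] [<-] /(IHW _ _ sX)[X1 [g' [X2 [W1 [Y' [W2 [-> -> -> [s1 s2 -> ->]]]]]]]].
  by exists (g :: X1), g', X2, ((true, Y) :: W1), Y', W2; rewrite /= s1.
- rewrite add0n => sX [<-] /(IHW _ _ sX)[X1 [g' [X2 [W1 [Y' [W2 [-> -> -> [s1 s2 -> ->]]]]]]]].
  by exists X1, g', X2, ((false, Y) :: W1), Y', W2; rewrite /= s1.
Qed.

Lemma refine_split c Z L V R : refine c Z = L ++ (true, V) :: R ->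
  exists Z1 X Z2 L' R', [/\ Z = Z1 ++ (true, X) :: Z2,
    fill (c + special Z1) X bot = L' ++ (true, V) :: R', L = refine c Z1 ++ L'
    & R = R' ++ (false, rev X) :: refine (c + special Z1).+1 Z2].
Proof.
rewrite /special; elim: Z c L => [|[[] X] Z IHZ] c L /=; first by case: L.
  move=> SE; case: (cat_split_cons SE) => [[R' fE ->]|[[|e L'] -> //]].
    by exists [::], X, Z, L, R'; rewrite addn0.
  case=> <- /IHZ[Z1 [X' [Z2 [L2 [R' [-> fE -> ->]]]]]].
  by exists ((true, X) :: Z1), X', Z2, L2, R'; rewrite /= addnA addn1 -catA.
case: L => [//|e L] [<-] /IHZ[Z1 [X' [Z2 [L2 [R' [-> fE -> ->]]]]]].
by exists ((false, X) :: Z1), X', Z2, L2, R'; rewrite /= add0n.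
Qed.

Section Facts.
Variables (k j F D Ft Dt : nat) (Z0 : seq (bool * seq nat)).
Hypothesis (HZ : marked k F Ft Dt Nt Z0) (Hb : marked k.+1 j F D Nb bot).

Let blockP X : (true, X) \in Z0 -> [/\ size X = special bot, uniq X & {in X, forall x, x < Nt}].
Proof. by case/(marked_block HZ) => /(_ erefl) sX uX XN; rewrite (marked_special Hb). Qed.

Let topN e x : e \in Z0 -> x \in e.2 -> x < Nt.
Proof. by case/(marked_block HZ) => _ _; apply. Qed.

Let botN x : x \in words bot -> x < Nb.
Proof. by case/flattenP => _ /mapP[e /(marked_block Hb)[_ _ eN] ->] /eN. Qed.

Lemma mem_refine c Z x : {subset Z <= Z0} -> x \in words (refine c Z) ->
  (x < Nt) && (x \in words Z) \/ Nt + c * Nb <= x < Nt + (c + special Z) * Nb.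
Proof.
rewrite /special; elim: Z c => //= -[sp X] Z IHZ c ZZ.
have {}IHZ c' := IHZ c' (fun e eZ => ZZ e (mem_behead (s := _ :: _) eZ)).
have {ZZ}XZ : (sp, X) \in Z0 by apply: ZZ; rewrite mem_head.
rewrite /words /= mem_cat -/(words Z); case: sp XZ => XZ /=.
  have [sX uX XN] := blockP XZ.
  rewrite -/(words _) words_cat mem_cat mem_fill // /words /= mem_cat mem_rev -!orbA.
  case/or4P => [xX|/mapP[y /botN yN ->]|xX|/IHZ[]].
  - by left; rewrite XN // xX.
  - by right; rewrite /copy_symbol; nia.
  - by left; rewrite XN // xX.
  - by move=> /andP[xN xZ]; left; rewrite xN xZ orbT.
  - by right; nia.
rewrite -/(words _) mem_cat => /orP[xX|/IHZ[/andP[xN xZ]|]].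
- by left; rewrite (topN XZ) // xX.
- by left; rewrite xN xZ orbT.
- by right.
Qed.

Lemma notin_refine c c' Z y : {subset Z <= Z0} -> y < Nb ->
  (c' < c) || (c + special Z <= c') -> shift c' y \notin words (refine c Z).
Proof.
move=> ZZ yN cc; apply/negP => /(mem_refine ZZ); rewrite /copy_symbol.
by case=> [/andP[]|]; nia.
Qed.

Lemma filter_refine c Z : {subset Z <= Z0} ->
  filter (fun x => x < Nt) (words (refine c Z))
  = flatten [seq if e.1 then e.2 ++ rev e.2 else e.2 | e <- Z].
Proof.
elim: Z c => //= -[sp X] Z IHZ c ZZ.
have {}IHZ c' := IHZ c' (fun e eZ => ZZ e (mem_behead (s := _ :: _) eZ)).
have {ZZ}XZ : (sp, X) \in Z0 by apply: ZZ; rewrite mem_head.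
have XNt (Y : seq nat) : {subset Y <= X} -> filter (fun x => x < Nt) Y = Y.
  by move=> YX; apply/all_filterP/allP => x /YX; exact: (topN XZ).
case: sp XZ => XZ /=; last by rewrite /words /= filter_cat -/(words _) IHZ XNt.
have [sX uX XN] := blockP XZ.
rewrite words_cat filter_cat filter_fill_lt // /words /= filter_cat -/(words _) IHZ XNt ?catA //.
by move=> x; rewrite mem_rev.
Qed.

Lemma top_decomp y : y < Ft -> exists Z1 X Z2, Z0 = Z1 ++ (true, X) :: Z2 /\ special Z1 = y.
Proof.
rewrite -(marked_special HZ) /special; elim: (Z0) y => //= -[[] X] Z IHZ [|y] //=.
- by exists [::], X, Z.
- by rewrite add1n ltnS => /IHZ[Z1 [Y [Z2 [-> <-]]]]; exists ((true, X) :: Z1), Y, Z2.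
- by rewrite add0n => /IHZ[Z1 [Y [Z2 [-> z1]]]]; exists ((false, X) :: Z1), Y, Z2.
- by rewrite add0n => /IHZ[Z1 [Y [Z2 [-> z1]]]]; exists ((false, X) :: Z1), Y, Z2; rewrite /= z1.
Qed.

Lemma local_decomp y : Nt <= y < Nt + Ft * Nb -> exists v Z1 X Z2,
  [/\ y = shift (special Z1) v, v < Nb, Z0 = Z1 ++ (true, X) :: Z2 & special Z1 < Ft].
Proof.
move=> yP; have Nb0 : 0 < Nb by case: (Nb) yP => //; lia.
have cF : (y - Nt) %/ Nb < Ft by rewrite ltn_divLR //; lia.
have [Z1 [X [Z2 [ZE Z1E]]]] := top_decomp cF.
exists ((y - Nt) %% Nb), Z1, X, Z2; rewrite ZE Z1E; split=> //; last by rewrite ltn_mod.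
by rewrite /copy_symbol -addnA -divn_eq; lia.
Qed.

Lemma size_refine c Z : special (refine c Z) = special Z * special bot
  /\ size (refine c Z) = size Z + special Z * size bot
  /\ size (words (refine c Z)) = size (words Z) + special Z * (special bot + size (words bot)).
Proof.
elim: Z c => [|[[] X] Z IHZ] c //.
  have -> : refine c ((true, X) :: Z) = fill c X bot ++ (false, rev X) :: refine c.+1 Z by [].
  rewrite words_cat !words_cons special_cat !special_cons special_fill !size_cat size_words_fill.
  by rewrite size_fill size_rev /=; have [-> [-> ->]] := IHZ c.+1; lia.
have -> : refine c ((false, X) :: Z) = (false, X) :: refine c Z by [].
rewrite !words_cons !special_cons !size_cat /=.
by have [-> [-> ->]] := IHZ c; lia.
Qed.

Let fresh_top L X R a : Z0 = L ++ (true, X) :: R -> a \in X -> a \notin words L.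
Proof. exact: (marked_fresh HZ). Qed.

Let mem_top L e R : Z0 = L ++ e :: R -> e \in Z0.
Proof. by move=> ->; rewrite mem_cat mem_head orbT. Qed.

Let subL L e R : Z0 = L ++ e :: R -> {subset L <= Z0}.
Proof. by move=> -> f fL; rewrite mem_cat fL. Qed.

Let subR L e R : Z0 = L ++ e :: R -> {subset R <= Z0}.
Proof. by move=> -> f fR; rewrite mem_cat inE fR !orbT. Qed.

(* The special block containing [a] and [b] (in this order) becomes, on these
   two letters, [a b b a]: they are inserted once in the copy of [bot] and then
   reversed. *)
Lemma runs_global_shared L X R a b : Z0 = L ++ (true, X) :: R -> a != b -> a \in X -> b \in X ->
  subseq [:: a; b] X ->
  runs a b false (words (refine 0 Z0)) <= 2 /\ runs b a false (words (refine 0 Z0)) <= 2.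
Proof.
move=> ZE ab aX bX sX; have XZ := mem_top ZE; have [_ uX XN] := blockP XZ.
have [aN bN] := (XN _ aX, XN _ bX).
have runsE u v : u < Nt -> v < Nt -> runs u v false (words (refine 0 Z0)) =
    runs u v false (flatten [seq if e.1 then e.2 ++ rev e.2 else e.2 | e <- Z0]).
  by move=> uN vN; rewrite -(filter_refine 0 (Z := Z0)) // runs_filter.
rewrite !runsE //.
have notL x : x \in X -> x \notin flatten [seq if e.1 then e.2 ++ rev e.2 else e.2 | e <- L].
  move=> /(fresh_top ZE); apply: contra => /flattenP[_ /mapP[e eL ->] xe].
  by apply: (mem_words eL); move: xe; case: (e.1); rewrite ?mem_cat ?mem_rev ?orbb.
have notR x Y : x \in X -> (true, Y) \in R -> x \notin Y.
  move=> xX YR; apply/negP => xY; have [R1 [R2 RE]] : exists R1 R2, R = R1 ++ (true, Y) :: R2.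
    by case/splitPr: YR => R1 R2; exists R1, R2.
  have := @fresh_top (L ++ (true, X) :: R1) Y R2 x; rewrite -catA /= -RE => /(_ ZE xY).
  by rewrite words_cat mem_cat negb_or /words /= mem_cat xX andbF.
have eqR u v st : u \in X -> v \in X ->
    runs u v st (flatten [seq if e.1 then e.2 ++ rev e.2 else e.2 | e <- R]) = runs u v st (words R).
  move=> uX' vX; rewrite /words /unzip2.
  case: (@runs_expand u v _ snd (fun e => if e.1 then e.2 ++ rev e.2 else e.2) R st) => [[[] Y] YR|-> _] //=.
    right; rewrite (notR u Y) //; split=> // x; by rewrite mem_cat mem_rev orbb.
  by left.
have XE : filter (pred2 a b) (X ++ rev X) = [:: a; b; b; a].
  by rewrite filter_cat filter_rev (filter_pair uX sX).
have nR := marked_shared HZ ZE sX.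
rewrite ZE map_cat /= flatten_cat /=; move: (X ++ rev X) XE => W XE; rewrite !runs_cat.
split.
  rewrite runs_notin ?notL // in_run_notin ?notL //= add0n eqR //.
  rewrite -(@runs_filter a b (pred2 a b) false W) ?inE ?eqxx ?orbT //.
  rewrite -(@in_run_filter a b (pred2 a b) false W) ?inE ?eqxx ?orbT //.
  rewrite XE /= !eqxx (negbTE ab) /= ; apply: (leq_add (leqnn 1)).
  by apply: leq_trans (runs_before nR) _; case: (in_run _ _ _ _).
rewrite runs_notin ?notL // in_run_notin ?notL //= add0n eqR //.
rewrite -(@runs_filter b a (pred2 a b) false W) ?inE ?eqxx ?orbT //.
rewrite -(@in_run_filter b a (pred2 a b) false W) ?inE ?eqxx ?orbT //.
rewrite XE /= !eqxx (eq_sym b) (negbTE ab) /=.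
have ba : b != a by rewrite eq_sym.
by have := @runs_after b a ba true _ nR; rewrite leqn0 => /eqP->.
Qed.

Lemma runs_global a b : a != b -> a < Nt -> b < Nt -> runs a b false (words (refine 0 Z0)) <= 2.
Proof.
move=> ab aN bN.
have [/hasP[[[] X] XZ /and3P[//= _ aX bX]]|/hasPn nsh] :=
    boolP (has (fun e => [&& e.1, a \in e.2 & b \in e.2]) Z0).
  have [L [R ZE]] : exists L R, Z0 = L ++ (true, X) :: R by case/splitPr: XZ => L R; exists L, R.
  have [_ uX _] := blockP XZ.
  case/orP: (subseq_pair ab aX bX) => sX; first by case: (runs_global_shared ZE ab aX bX sX).
  by rewrite eq_sym in ab; case: (runs_global_shared ZE ab bX aX sX).
rewrite -(@runs_filter _ _ (fun x => x < Nt)) // filter_refine //.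
case: (@runs_expand a b _ snd (fun e => if e.1 then e.2 ++ rev e.2 else e.2) Z0 false) => [[[] Y] YR|-> _] /=.
- right; have := nsh _ YR; rewrite /= negb_and => ->; split=> // x.
  by rewrite mem_cat mem_rev orbb.
- by left.
- exact: (marked_runs HZ).
Qed.

Lemma runs_notin_le1 a b st w : a \notin w -> runs a b st w <= 1.
Proof. by move=> aw; rewrite runs_notin_sep //; apply: leq_b1. Qed.

(** Here the runs of both symbols matter. A global a cuts the runs of a local b at most once. If a
    is inserted in the copy of b, that is its first occurrence, followed by at most one run after
    the copy; otherwise a has at most one run before and one after the copy. Shuffling first
    occurrences only is what excludes a third run. *)
Lemma runs_local a b : a != b -> a < Nt + Ft * Nb -> Nt <= b < Nt + Ft * Nb ->
  runs a b false (words (refine 0 Z0)) <= 2 /\ runs b a false (words (refine 0 Z0)) <= 2.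
Proof.
move=> ab aN bP; have [v [Z1 [X [Z2 [bE vN ZE Z1F]]]]] := local_decomp bP.
have [[XZ S1] S2] := (mem_top ZE, subL ZE, subR ZE); have [sX uX XN] := blockP XZ.
set c := special Z1 in bE Z1F.
have n1 u : u < Nb -> shift c u \notin words (refine 0 Z1).
  by move=> uN; apply: notin_refine => //; rewrite add0n leqnn orbT.
have n2 u : u < Nb -> shift c u \notin words ((false, rev X) :: refine c.+1 Z2).
  move=> uN; rewrite /words /= mem_cat mem_rev negb_or; apply/andP; split.
    by apply/negP => /XN; rewrite /copy_symbol; lia.
  by apply: notin_refine => //; rewrite ltnSn.
have -> : words (refine 0 Z0) =
    words (refine 0 Z1) ++ words (fill c X bot) ++ words ((false, rev X) :: refine c.+1 Z2).
  by rewrite ZE refine_cat /= add0n -/c !words_cat.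
set s1 := words (refine 0 Z1) in n1 *; set s3 := words (_ :: _) in n2 *; clearbody s3.
have b1 := n1 _ vN; have b3 := n2 _ vN; rewrite -bE in b1 b3.
have [aNt|Nta] := ltnP a Nt.
  have ca : count_mem a (words (fill c X bot)) = (a \in X).
    have := count_uniq_mem a uX; rewrite -{1}(filter_fill_lt c sX XN) count_filter => <-.
    by apply: eq_count => x /=; case: eqP => // ->.
  split; rewrite !runs_cat.
    rewrite (runs_notin _ _ b1) (runs_notin _ _ b3) addn0 add0n.
    by apply: leq_trans (runs_count _ _ _ _) _; rewrite ca; case: (in_run _ _ _ _); case: (a \in X).
  have [aX|aX] := boolP (a \in X).
    rewrite (@runs_notin _ _ _ s1); last first.
      by apply/negP => /(mem_refine S1)[/andP[_]|]; [apply/negP; exact: fresh_top ZE aX|lia].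
    rewrite add0n; apply: (@leq_add _ _ 1 1); last exact: runs_notin_le1.
    by apply: leq_trans (runs_count_mem _ _ _ _) _; rewrite ca aX.
  rewrite (@runs_notin _ _ _ (words (fill c X bot))); last by rewrite -has_pred1 has_count ca (negbTE aX).
  by apply: (@leq_add _ _ 1 1); rewrite ?add0n runs_notin_le1.
have [u [Y1 [X' [Y2 [aE uN YE Y1F]]]]] := local_decomp (ltac:(by rewrite Nta) : Nt <= a < Nt + Ft * Nb).
have [cc|cc] := eqVneq (special Y1) c.
  rewrite cc in aE; have a1 := n1 _ uN; have a3 := n2 _ uN; rewrite -aE in a1 a3.
  have loc x y : x < Nb -> y < Nb -> x != y ->
      runs (shift c x) (shift c y) false (words (fill c X bot)) <= 2.
    move=> xN yN xy; rewrite -(@runs_filter _ _ (fun x => Nt <= x)) /=; last 2 first.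
    - by rewrite /copy_symbol -addnA leq_addr.
    - by rewrite /copy_symbol -addnA leq_addr.
    rewrite filter_fill_ge // runs_map => [|z _|z _]; last 2 first.
    - by rewrite (can_eq (copy_symbolK _ _ _)).
    - by rewrite (can_eq (copy_symbolK _ _ _)).
    exact: (marked_runs Hb).
  have uv : u != v by apply: contra ab => /eqP uv; rewrite aE bE uv.
  split; rewrite !runs_cat.
    rewrite (runs_notin _ _ b1) (runs_notin _ _ b3) in_run_notin //= addn0 add0n aE bE.
    exact: loc.
  rewrite (runs_notin _ _ a1) (runs_notin _ _ a3) in_run_notin //= addn0 add0n aE bE.
  by apply: loc; rewrite // eq_sym.
have an : a \notin words (fill c X bot).
  rewrite mem_fill // negb_or; apply/andP; split.
    by apply/negP => /XN; lia.
  by apply/mapP => -[z /botN zN]; move: cc; rewrite aE /copy_symbol; nia.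
split; rewrite !runs_cat.
  by rewrite (runs_notin _ _ b1) (runs_notin _ _ b3) addn0 add0n ltnW // ltnS runs_notin_le1.
rewrite (runs_notin _ _ an) add0n.
by apply: (@leq_add _ _ 1 1); apply: runs_notin_le1.
Qed.

Lemma marked_refine :
  marked k.+1 j.+1 (Ft * F) (Dt + Ft * D.+1) (Nt + Ft * Nb) (refine 0 Z0).
Proof.
have [h1 [h2 h3]] := size_refine 0 Z0.
have [[FE sZ] sb] := (marked_special HZ, marked_size HZ, marked_size Hb).
have [[FbE wZ] wb] := (marked_special Hb, marked_weight HZ, marked_weight Hb).
have [cZ cb] := (marked_card HZ, marked_card Hb).
split.
- by rewrite h1 FE FbE.
- by rewrite h2 FE sZ sb; lia.
- suff blk c Z e : {subset Z <= Z0} -> c + special Z <= Ft -> e \in refine c Z ->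
      [/\ e.1 = true -> size e.2 = j.+1, uniq e.2 & {in e.2, forall x, x < Nt + Ft * Nb}].
    by move=> e; apply: blk; rewrite // FE.
  elim: Z c => //= -[sp X] Z IHZ c ZZ.
  have {}IHZ c' := IHZ c' (fun e eZ => ZZ e (mem_behead (s := _ :: _) eZ)).
  have {ZZ}XZ : (sp, X) \in Z0 by apply: ZZ; rewrite mem_head.
  rewrite /special /= -/(special _).
  have [_ /= uX /= XN] := marked_block HZ XZ; case: sp XZ => XZ.
    have [sX _ _] := blockP XZ; rewrite mem_cat inE => cF.
    case/or3P => [/(fill_block sX)[Y YW eE]|/eqP->|]; last by apply: IHZ; lia.
      have [sY uY YN] := marked_block Hb YW.
      case: (e.1) sY eE => [/(_ erefl) sY [g gX ->]|_ ->].
        rewrite size_rcons size_map sY rcons_uniq (map_inj_uniq (can_inj (copy_symbolK _ _ _))) uY andbT.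
        split=> //; first by apply/mapP => -[z _]; have := XN _ gX; rewrite /copy_symbol; lia.
        move=> x; rewrite mem_rcons inE => /predU1P[->|/mapP[z /YN zN ->]].
          by have := XN _ gX; lia.
        by rewrite /copy_symbol; nia.
      split=> //; first by rewrite (map_inj_uniq (can_inj (copy_symbolK _ _ _))).
      by move=> x /mapP[z /YN zN ->]; rewrite /copy_symbol; nia.
    by split=> //=; [rewrite rev_uniq|move=> x; rewrite mem_rev => /XN; lia].
  rewrite inE => cF /predU1P[->|]; last by apply: IHZ; lia.
  by split=> //= x /XN; lia.
- by rewrite cZ cb; nia.
- by rewrite h3 FE FbE wZ wb cZ cb; nia.
- move=> a b ab aN bN; have [aNt|Nta] := ltnP a Nt; have [bNt|Ntb] := ltnP b Nt.
  + exact: runs_global.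
  + by have [] := @runs_local a b ab aN ltac:(by rewrite Ntb).
  + by rewrite eq_sym in ab; have [] := @runs_local b a ab bN ltac:(by rewrite Nta).
  + by have [] := @runs_local a b ab aN ltac:(by rewrite Ntb).
- move=> L V R a SE aV.
  have [Z1 [X [Z2 [L1 [R1 [ZE fE -> _]]]]]] := refine_split SE.
  have [[XZ S1] S2] := (mem_top ZE, subL ZE, subR ZE); have [sX uX XN] := blockP XZ.
  have [X1 [g [X2 [W1 [Y [W2 [XE botE VE [s1 s2 L1E _]]]]]]]] := fill_split sX fE.
  have gX : g \in X by rewrite XE mem_cat mem_head orbT.
  rewrite words_cat mem_cat negb_or L1E mem_fill // negb_or.
  move: aV; rewrite VE mem_rcons inE => /predU1P[->|/mapP[y yY ->]]; apply/and3P; split.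
  + apply/negP => /(mem_refine S1)[/andP[_]|]; first by apply/negP; exact: fresh_top ZE gX.
    by have := XN _ gX; lia.
  + by move: uX; rewrite XE cat_uniq /= negb_or => /and3P[_ /andP[]].
  + by apply/mapP => -[z _]; have := XN _ gX; rewrite /copy_symbol; lia.
  + apply: notin_refine => //; last by rewrite add0n leqnn orbT.
    by apply: botN; rewrite botE words_cat mem_cat /words /= mem_cat yY orbT.
  + apply/negP => y1; have : shift (0 + special Z1) y < Nt by apply: XN; rewrite XE mem_cat y1.
    by rewrite /copy_symbol; lia.
  + by rewrite (mem_map (can_inj (copy_symbolK _ _ _))); exact: (marked_fresh Hb botE yY).
- move=> L V R a b SE abV.
  have [Z1 [X [Z2 [L1 [R1 [ZE fE _ ->]]]]]] := refine_split SE.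
  have [[XZ S1] S2] := (mem_top ZE, subL ZE, subR ZE); have [sX uX XN] := blockP XZ.
  have [X1 [g [X2 [W1 [Y [W2 [XE botE VE [s1 s2 _ R1E]]]]]]]] := fill_split sX fE.
  rewrite add0n in VE R1E *; set c := special Z1 in VE R1E *.
  have gX : g \in X by rewrite XE mem_cat mem_head orbT.
  have gY : g \notin map (shift c) Y.
    by apply/mapP => -[z _]; have := XN _ gX; rewrite /copy_symbol; lia.
  (* The only global symbol of the block is its last, so a, having b behind it, is local. *)
  have aY : a \in map (shift c) Y.
    move: abV; rewrite VE -cats1; apply: contraLR => aY; apply/negP => /(subseq2_catr aY) /=.
    by case: ifP.
  have [y yY aE] := mapP aY.
  have yN : y < Nb by apply: botN; rewrite botE words_cat mem_cat /words /= mem_cat yY orbT.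
  have a3 : a \notin words ((false, rev X) :: refine c.+1 Z2).
    rewrite /words /= mem_cat mem_rev negb_or aE; apply/andP; split.
      by apply/negP => /XN; rewrite /copy_symbol; lia.
    by apply: notin_refine => //; rewrite ltnSn.
  (* If b is the global symbol, it does not recur within this copy, while a does not occur after the
     copy. *)
  rewrite words_cat; have [bg|bg] := eqVneq b g.
    rewrite subseq2_cat // bg R1E mem_fill // negb_or; apply/andP; split.
      by move: uX; rewrite XE cat_uniq /= => /and3P[_ _ /andP[]].
    by apply/mapP => -[z _]; have := XN _ gX; rewrite /copy_symbol; lia.
  have abY : subseq [:: a; b] (map (shift c) Y).
    by move: abV; rewrite VE -cats1 => /subseq2_catl; apply; rewrite inE.
  have [z zY bE] : exists2 z, z \in Y & b = shift c z.
    by apply/mapP/(mem_subseq abY); rewrite !inE eqxx orbT.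
  have unshift u v s : subseq [:: shift c u; shift c v] (map (shift c) s) -> subseq [:: u; v] s.
    move/(map_subseq (subn^~ (Nt + c * Nb))).
    by rewrite mapK /=; [rewrite !copy_symbolK|exact: copy_symbolK].
  rewrite aE bE in abY; have yz := unshift _ _ _ abY.
  apply: contra (marked_shared Hb botE yz) => /(subseq2_catl a3) baR; apply: (unshift).
  have XN2 : {in X2, forall x, x < Nt} by move=> x x2; apply: XN; rewrite XE mem_cat inE x2 !orbT.
  rewrite -(filter_fill_ge c s2 XN2) -R1E subseq_filter -aE -bE baR andbT /=.
  by rewrite aE bE /copy_symbol; lia.
Qed.
End Facts.
End Refine.

(** * Existence for order three *)

Lemma marked_start j : marked 0 j 2 0 (2 * j) [:: (true, iota 0 j); (true, iota j j)].
Proof.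
have wE : words [:: (true, iota 0 j); (true, iota j j)] = iota 0 (j + j).
  by rewrite !words_cons cats0 iotaD add0n.
split=> //.
- move=> e; rewrite !inE => /orP[] /eqP->; rewrite /= size_iota iota_uniq; split=> // x;
    by rewrite mem_iota; lia.
- by rewrite wE size_iota; lia.
- move=> a b ab aN bN; rewrite wE; apply: leq_trans (runs_count_mem _ _ _ _) _.
  by rewrite count_uniq_mem ?iota_uniq //; case: (b \in _).
- move=> [|e [|? []]] X R a //= [<- <- _] aX.
  by rewrite words_cons cats0 /= mem_iota; rewrite mem_iota in aX; lia.
- move=> L X R a b; case: L => [|e [|f L]] SE abX.
  + case: SE => XE RE; rewrite -XE in abX; rewrite -RE words_cons cats0; apply/negP => /mem_subseq/(_ b).
    rewrite !inE eqxx => /(_ isT); rewrite mem_iota.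
    by have /(_ b) := mem_subseq abX; rewrite !inE eqxx orbT mem_iota => /(_ isT); lia.
  + by case: SE => _ _ RE; rewrite -RE.
  + by case: SE => _ _; case: L.
Qed.

Lemma marked_empty k : marked k 0 2 0 0 [:: (true, [::]); (true, [::])].
Proof.
have XE L X R : [:: (true, [::]); (true, [::])] = L ++ (true, X) :: R -> X = [::] :> seq nat.
  move=> SE; have : (true, X) \in [:: (true, [::]); (true, [::])].
    by rewrite SE mem_cat mem_head orbT.
  by rewrite !inE orbb => /eqP[->].
split=> //.
- by move=> e; rewrite !inE => /orP[] /eqP->.
- by rewrite muln0.
- by move=> L X R a /XE->.
- by move=> L X R a b /XE->.
Qed.

(** The slack [2 * k] in the count of ordinary blocks pays for the reversed block added after each
    copy. Together with [1 < F] it closes the induction, which is why the initial sequences have two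
    special blocks. *)
Lemma exists_marked k j : exists F D N Z,
  [/\ marked k j F D N Z, D + 2 * k <= k * F & 1 < F <= ack k.+1 (16 * j.+1)].
Proof.
have ack_ge2 i m : 0 < m -> 1 < ack i m by move=> m0; apply: leq_trans (ack_double _ _); rewrite -addnn; lia.
elim: k j => [|k IHk] j.
  exists 2, 0, (2 * j), [:: (true, iota 0 j); (true, iota j j)].
  by rewrite ack_ge2 //; split=> //; exact: marked_start.
elim: j => [|j [F [D [N [bot [Hb DF /andP[F1 FE]]]]]]].
  exists 2, 0, 0, [:: (true, [::]); (true, [::])].
  by rewrite ack_ge2 //; split; [exact: marked_empty|lia|].
have [Ft [Dt [Nt [Z [HZ DFt /andP[Ft1 FtE]]]]]] := IHk F.
exists (Ft * F), (Dt + Ft * D.+1), (Nt + Ft * N), (refine Nt N bot 0 Z); split.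
- exact: marked_refine.
- by nia.
apply/andP; split; first by nia.
rewrite [16 * _]mulnS iter_ackD -[Ft]muln1.
apply: (ack_block_bound (l := F)) FE _ _ FtE => //.
- by apply: leq_trans (ack_double _ _); lia.
- by apply: leq_trans (ack_double _ _); lia.
- by rewrite mul1n.
Qed.

(** Special blocks of length k + 1 give [F * k.+1] symbols and at most as many blocks, so the
    incidence matrix fits into a square. The level shift 4 is one from [exists_marked] and three
    from [ack_diag_bound]. *)
Lemma exists_marked_square k : exists F D N Z,
  [/\ marked k k.+1 F D N Z, F + D <= N & 0 < N <= ack (k + 4) 3].
Proof.
have [F [D [N [Z [HZ DF /andP[F1 FE]]]]]] := exists_marked k k.+1.
exists F, D, N, Z; split=> //; rewrite (marked_card HZ); first by nia.
apply/andP; split; first by nia.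
have L3 : k < ack k.+1 32.
  by apply: leq_trans (ack3_gt k) _; apply: leq_trans (leq_ack_lvl _ (leqnSn k)); exact: leq_ack.
rewrite -[k + 4]addSnnS; apply: ack_diag_bound.
have F4 : F <= ack k.+1 (16 * (ack k.+1 32).+1) by apply: leq_trans FE (leq_ack _ _); lia.
have k4 : k.+1 <= ack k.+1 (16 * (ack k.+1 32).+1).
  by apply: leq_trans (ack_double _ _); rewrite -addnn; lia.
apply: leq_trans (leq_mul F4 k4) (sqr_le_ack _ _) => //.
by apply: leq_trans (ack_double _ _); rewrite -addnn; lia.
Qed.
(** * Matrices without two-row formations *)

Definition two_form (A : nat -> nat -> bool) s a b (ya yb : nat -> nat) : Prop :=
  [/\ forall j, j < s -> A (ya j) a, forall j, j < s -> A (yb j) b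
    & forall j k, j < k -> k < s -> maxn (ya j) (yb j) < minn (ya k) (yb k)].

Lemma two_form_sym A s a b ya yb : two_form A s a b ya yb -> two_form A s b a yb ya.
Proof. by move=> [Aa Ab yy]; split=> // j k jk ks; rewrite maxnC minnC yy. Qed.

Definition entry (S : seq (seq nat)) y x := x \in nth [::] S y.

Lemma subseq_chain S (x z : nat -> nat) n k c :
  (forall j, k <= j < k + n -> entry S (z j) (x j)) ->
  (forall j, k <= j -> j.+1 < k + n -> z j < z j.+1) -> (0 < n -> c <= z k) ->
  subseq [seq x j | j <- iota k n] (flatten (drop c S)).
Proof.
elim: n k c => [|n IHn] k c xz zz cz /=; first exact: sub0seq.
have zk : entry S (z k) (x k) by apply: xz; lia.
have zS : z k < size S by rewrite ltnNge; apply/negP => zS; rewrite /entry nth_default in zk.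
have dE : drop (z k - c) (drop c S) = nth [::] S (z k) :: drop (z k).+1 S.
  by rewrite drop_drop subnK ?cz // (drop_nth [::] zS).
rewrite -(cat_take_drop (z k - c) (drop c S)) dE flatten_cat; apply: subseq_trans (suffix_subseq _ _).
rewrite -cat1s; apply: cat_subseq; first by rewrite sub1seq.
apply: IHn => [j jP|j kj jn|n0]; [apply: xz; lia|apply: zz; lia|apply: zz; lia].
Qed.

Lemma runs_closed a b w : runs a b false w <= (runs a b true w).+1.
Proof.
elim: w => //= x w IHw; case: ifP => _; first by rewrite add1n.
by case: ifP.
Qed.

Lemma runs_subseq a b st w' w : subseq w' w -> runs a b st w' <= runs a b st w.
Proof.
elim: w w' st => [|x w IHw] w' st; first by rewrite subseq0 => /eqP->.
have weak : subseq w' w -> runs a b st w' <= runs a b st (x :: w).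
  move=> /IHw h /=; apply: leq_trans (h st) _.
  by case: ifP => _; [|case: ifP => _ //]; case: st;
    rewrite ?add1n ?add0n ?runs_closed ?runs_open.
case: w' weak => [|y w'] weak //; rewrite [subseq _ _]/=; have [->|_ //] := eqVneq.
by move=> sw /=; case: ifP => _; rewrite ?leq_add2l; exact: IHw.
Qed.

Lemma alternation_runs a b k h : a != b -> ~~ odd k ->
  runs a b false [seq (if odd j then a else b) | j <- iota k h.*2.+1] = h.+1.
Proof.
move=> ab; elim: h k => [|h IHh] k ek; first by rewrite /= (negbTE ek) eqxx.
have /IHh/= : ~~ odd k.+2 by rewrite /= negbK.
by rewrite !negbK (negbTE ek) /= ?eqnE !eqxx (negbTE ab) /= ?eqnE ?eqxx /= !add1n => ->.
Qed.

Lemma entry_flatten S y x : entry S y x -> x \in flatten S.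
Proof.
move=> Sx; apply/flattenP; exists (nth [::] S y) => //; apply: mem_nth.
by rewrite ltnNge; apply/negP => yS; rewrite /entry nth_default in Sx.
Qed.

(** Reading b, a, b, ..., b from 2h + 1 successive groups gives h + 1 runs of b. The rows can be
    exchanged, so a bound for the larger symbol suffices. *)
Lemma no_form_even S h a b ya yb : a != b ->
  (forall a b, a < b -> b \in flatten S -> runs a b false (flatten S) <= h) ->
  ~ two_form (entry S) h.*2.+1 a b ya yb.
Proof.
move=> ab Sh; wlog lt_ab : a b ya yb ab / a < b => [th|] tf.
  have [lt_ab|lt_ba|abE] := ltngtP a b; first exact: th tf.
    by apply: th (two_form_sym tf); rewrite // eq_sym.
  by rewrite abE eqxx in ab.
have [Aa Ab yy] := tf.
have sub : subseq [seq (if odd j then a else b) | j <- iota 0 h.*2.+1] (flatten (drop 0 S)).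
  apply: (subseq_chain (z := fun j => if odd j then ya j else yb j)) => //.
    by move=> j jP; case: ifP => _; [apply: Aa|apply: Ab].
  by move=> j _ jh /=; have := yy j j.+1 (ltnSn j) jh; case: ifP => _ /=; lia.
have := runs_subseq a b false sub; rewrite alternation_runs // drop0 => hr.
by have := leq_trans hr (Sh a b lt_ab (entry_flatten (Ab 0 isT))); rewrite ltnn.
Qed.

(** The first group alone yields both letters in some order c d, even if they lie in the same block.
    The other three groups yield c d c, and c d c d c has three runs of c. As c may be either
    symbol, the run bound is needed for both. *)
Lemma no_form_four S a b ya yb : a != b ->
  (forall a b, a != b -> a \in flatten S -> b \in flatten S -> runs a b false (flatten S) <= 2) ->
  ~ two_form (entry S) 4 a b ya yb.
Proof.
move=> ab S2 tf0.
have key c d yc yd : two_form (entry S) 4 c d yc yd -> c != d ->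
    subseq [:: c; d] (flatten (take (maxn (yc 0) (yd 0)).+1 S)) -> False.
  move=> [Ac Ad yy] cd scd.
  have sub : subseq [seq (if odd j then c else d) | j <- iota 1 3]
      (flatten (drop (maxn (yc 0) (yd 0)).+1 S)).
    apply: (subseq_chain (z := fun j => if odd j then yc j else yd j)) => [j jP|j _ jh|_] /=.
    - by case: ifP => _; [apply: Ac|apply: Ad]; lia.
    - by have := yy j j.+1 (ltnSn j) jh; case: ifP => _ /=; lia.
    - by have := yy 0 1 isT isT; lia.
  have := cat_subseq scd sub; rewrite -flatten_cat cat_take_drop => /(runs_subseq d c false).
  have dc : (d == c) = false by rewrite eq_sym (negbTE cd).
  rewrite /= ?eqnE !eqxx ?dc ?(negbTE cd) /= ?eqnE ?eqxx ?dc /= => h3.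
  have [cS dS] := (entry_flatten (Ac 0 isT), entry_flatten (Ad 0 isT)).
  by rewrite eq_sym in cd; have := leq_trans h3 (S2 d c cd dS cS).
have mem_take y x m : entry S y x -> y <= m -> x \in flatten (take m.+1 S).
  by move=> Sx yc; apply: (@entry_flatten _ y); rewrite /entry nth_take.
have [Aa Ab yy] := tf0.
have := subseq_pair ab (mem_take _ _ _ (Aa 0 isT) (leq_maxl (ya 0) (yb 0)))
                       (mem_take _ _ _ (Ab 0 isT) (leq_maxr (ya 0) (yb 0))).
case/orP => [|sab]; first exact: key tf0 ab.
by apply: (key _ _ _ _ (two_form_sym tf0)); rewrite 1?eq_sym 1?maxnC.
Qed.

(** * Dense matrices and diagonal tilings *)

Definition dense_blocks s w N (S : seq (seq nat)) : Prop :=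
  [/\ size S <= N, {in S, forall X, uniq X /\ {in X, forall x, x < N}}, size (flatten S) = w * N
    & forall a b ya yb, a != b -> ~ two_form (entry S) s a b ya yb].

Lemma dense_odd t i : 0 < t ->
  exists N S, dense_blocks t.+1.*2.+1 (2 ^ lgmult t i) N S /\ 0 < N <= ack (i + t + 3) 3.
Proof.
move=> t0; have [N [S [[HS _ _] NE]]] := exists_outer i t0; exists N, S; split=> //.
have [sS bS _ _ rS] := HS; split=> [|X XS||a b ya yb ab].
- by rewrite sS.
- by have [_ uX XN] := bS X XS.
- rewrite size_flatten /shape mulnC -{1}sS; elim: (S) bS => //= X S' IHS bS.
  rewrite IHS => [|Y YS]; last by apply: bS; rewrite inE YS orbT.
  by have [-> _ _] := bS X (mem_head _ _).
- apply: (no_form_even ab) => c d cd /flattenP[X /bS[_ _ XN] /XN dN]; exact: rS.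
Qed.

Lemma dense_four k : exists N S, dense_blocks 4 k.+1 N S /\ 0 < N <= ack (k + 4) 3.
Proof.
have [F [D [N [Z [HZ FD NE]]]]] := exists_marked_square k; exists N, (unzip2 Z); split=> //.
have bZ X : X \in unzip2 Z -> uniq X /\ {in X, forall x, x < N}.
  by case/mapP => e /(marked_block HZ)[_ ue eN] ->.
split=> //; first by rewrite size_map (marked_size HZ).
  exact: marked_weight HZ.
move=> a b ya yb ab; apply: (no_form_four ab) => c d cd.
move=> /flattenP[X /bZ[_ XN] /XN cN] /flattenP[Y /bZ[_ YN] /YN dN].
exact: (marked_runs HZ).
Qed.

Lemma sum_mem N (X : seq nat) : uniq X -> {in X, forall x, x < N} ->
  \sum_(0 <= x < N) (x \in X) = size X.
Proof.
move=> uX XN; rewrite -sum1_size [RHS](perm_big [seq x <- iota 0 N | x \in X]) /=; last first.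
  apply: (uniq_perm uX); first by apply: filter_uniq; exact: iota_uniq.
  move=> x; rewrite mem_filter mem_iota add0n /=; by case: (boolP (x \in X)) => // /XN ->.
rewrite big_filter [RHS]big_mkcond /index_iota subn0.
by apply: eq_bigr => x _; case: (x \in X).
Qed.

Definition tile N (S : seq (seq nat)) y x := (x %/ N == y %/ N) && entry S (y %% N) (x %% N).

Lemma ltn_mod2 N y z : y %/ N = z %/ N -> y < z -> y %% N < z %% N.
Proof. by move=> e yz; rewrite -(ltn_add2l (y %/ N * N)) -divn_eq e -divn_eq. Qed.

(** The column of a in the first group precedes that of b in the second, and conversely; this forces
    both rows into the same diagonal copy. *)
Lemma tile_no_form s w N S a b ya yb : dense_blocks s w N S -> 1 < s -> a != b ->
  ~ two_form (tile N S) s a b ya yb.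
Proof.
move=> [_ _ _ nS] s2 ab [Aa Ab yy].
have qa j : j < s -> a %/ N = ya j %/ N /\ entry S (ya j %% N) (a %% N) by move=> /Aa/andP[/eqP].
have qb j : j < s -> b %/ N = yb j %/ N /\ entry S (yb j %% N) (b %% N) by move=> /Ab/andP[/eqP].
have s0 := ltnW s2; have q_ab : a %/ N = b %/ N.
  have := yy 0 1 isT s2; rewrite gtn_max !leq_min => /andP[/andP[_ ya0] /andP[yb0 _]].
  have [a0 _] := qa 0 s0; have [b0 _] := qb 0 s0.
  have [a1 _] := qa 1 s2; have [b1 _] := qb 1 s2.
  apply/eqP; rewrite eqn_leq; apply/andP; split; first by rewrite a0 b1 leq_div2r // ltnW.
  by rewrite b0 a1 leq_div2r // ltnW.
apply: (nS (a %% N) (b %% N) (fun j => ya j %% N) (fun j => yb j %% N)).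
  by apply: contra ab => /eqP rab; rewrite (divn_eq a N) (divn_eq b N) q_ab rab.
split=> [j /qa[]//|j /qb[]//|j k jk ks].
have js := ltn_trans jk ks; have := yy j k jk ks.
have [aj _] := qa j js; have [bj _] := qb j js; have [ak _] := qa k ks; have [bk _] := qb k ks.
rewrite !gtn_max !leq_min => /andP[/andP[aa ab'] /andP[ba bb]].
by rewrite !ltn_mod2 // -?aj -?ak -?bj -?bk // q_ab.
Qed.

Lemma sum_shift (F : nat -> nat) m n : \sum_(m <= i < m + n) F i = \sum_(0 <= i < n) F (i + m).
Proof. by rewrite -{1}[m]add0n big_addn addKn. Qed.

(** The complete copies cover at least half of the diagonal, whence the factor 2. *)
Lemma tile_weight s w N S n : dense_blocks s w N S -> 0 < N <= n ->
  n * w <= 2 * \sum_(0 <= y < n) \sum_(0 <= x < n) tile N S y x.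
Proof.
move=> [sS bS wS _] /andP[N0 Nn].
have block : \sum_(0 <= y < N) \sum_(0 <= x < N) entry S y x = w * N.
  rewrite (@eq_big_nat _ _ _ _ _ _ (fun y => size (nth [::] S y))); last first.
    move=> y _; have [yS|yS] := ltnP y (size S).
      by have [uX XN] := bS _ (mem_nth [::] yS); exact: sum_mem.
    by rewrite nth_default // big1 // => x _; rewrite /entry nth_default.
  rewrite -wS size_flatten sumnE big_map (big_nth [::]) [LHS](big_cat_nat (n := size S)) //=.
  rewrite [X in _ + X]big_nat [X in _ + X]big1 ?addn0 // => y /andP[yS _].
  by rewrite nth_default.
have tiled q : q * (w * N) <= \sum_(0 <= y < q * N) \sum_(0 <= x < q * N) tile N S y x.
  elim: q => // q IHq; rewrite mulSnr [q.+1 * N]mulSnr.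
  rewrite (big_cat_nat (n := q * N)) ?leq_addr //= leq_add //.
    apply: leq_trans IHq _; apply: leq_sum => y _.
    by rewrite [leqRHS](big_cat_nat (n := q * N)) ?leq_addr.
  rewrite -block sum_shift big_nat [leqRHS]big_nat; apply: leq_sum => y /andP[_ yN].
  rewrite [leqRHS](big_cat_nat (n := q * N)) ?leq_addr //= (leq_trans _ (leq_addl _ _)) //.
  rewrite sum_shift big_nat [leqRHS]big_nat; apply: leq_sum => x /andP[_ xN].
  by rewrite /tile ![_ + q * N]addnC !divnMDl // !divn_small // eqxx !modnMDl !modn_small.
have le_n : n %/ N * N <= n := leq_divM n N.
apply: (@leq_trans (2 * (n %/ N * (w * N)))).
  rewrite (mulnC w) !mulnA leq_mul2r; apply/orP; right.
  apply: leq_trans (ltnW (ltn_ceil n N0)) _; rewrite leq_mul2r; apply/orP; right.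
  by have : 0 < n %/ N; [rewrite divn_gt0|move: (n %/ N) => q; lia].
rewrite leq_mul2l /=; apply: leq_trans (tiled _) _.
rewrite [leqRHS](big_cat_nat (n := n %/ N * N)) //= (leq_trans _ (leq_addr _ _)) //.
by apply: leq_sum => y _; rewrite [leqRHS](big_cat_nat (n := n %/ N * N)) //= leq_addr.
Qed.
From mathcomp Require Import all_order all_algebra.
From mathcomp Require Import all_classical all_reals all_analysis.
From mathcomp Require Import ring lra.
Import Order.TTheory GRing.Theory Num.Theory.
Import numFieldNormedType.Exports.

(** * Transfer to higher dimension *)

Lemma form_choice (T : finType) (A : nat -> T -> bool) s (R : {set T}) l u : row_form A s R l u ->
  exists f : nat -> T -> nat,
    (forall j x, j < s -> x \in R -> [/\ l <= f j x, f j x < u & A (f j x) x]) /\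
    (forall j k x x', j < k -> k < s -> x \in R -> x' \in R -> f j x < f k x').
Proof.
elim: s l => [|s IHs] l /=; first by exists (fun _ _ => 0).
case=> m lm [cm /[dup] /form_le mu /IHs[f [fP fm]]].
have /choice[g gP] : forall x, exists y, x \in R -> l <= y < m /\ A y x.
  by move=> x; have [/cm[y yP Ay]|xR] := boolP (x \in R); [exists y|exists 0].
exists (fun j => if j is j'.+1 then f j' else g); split=> [[|j] x js xR|[|j] [|k] x x' jk ks xR x'R] //.
- by have [gl Ag] := gP x xR; split=> //; lia.
- by have [fl fu Af] := fP j x js xR; split=> //; lia.
- by have [gl Ag] := gP x xR; have [fl fu Af] := fP k x' ks x'R; lia.
- exact: fm.
Qed.

Section Transfer.
Variables (d n : nat) (p : 'I_d -> nat) (P : mx01 p).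
Notation rows := (mx_index (cube d n)).
Notation points := (mx_index (cube d.+1 n)).

Definition add1 (y : 'I_n) (r : rows) : points :=
  [ffun i => if unlift ord0 i is Some j then r j else y].

Lemma add1_0 y r : add1 y r ord0 = y.
Proof. by rewrite ffunE unlift_none. Qed.

Lemma del1_add1 y r : del1 (add1 y r) = r.
Proof. by apply/ffunP => i; rewrite !ffunE liftK. Qed.

Lemma add1_del1 (x : points) : add1 (x ord0) (del1 x) = x.
Proof.
apply/ffunP => i; rewrite ffunE; case: (unliftP ord0 i) => [j ->|->] //.
by rewrite ffunE.
Qed.

Lemma sum_points (F : points -> nat) : \sum_x F x = \sum_(r : rows) \sum_(y < n) F (add1 y r).
Proof.
rewrite pair_big /=.
rewrite (reindex (fun q : rows * 'I_n => add1 q.2 q.1)) //=.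
exists (fun x : points => (del1 x : rows, x ord0)) => [[r y] _|x _] /=.
  by rewrite del1_add1 add1_0.
exact: add1_del1.
Qed.

Lemma card_ones_eq (M : mx01 (cube d.+1 n)) : #|ones M| = \sum_(r : rows) \sum_(y < n) M (add1 y r).
Proof.
rewrite -(sum_points (fun x => M x)) -sum1_card big_mkcond; apply: eq_bigr => x _.
by rewrite inE; case: (M x).
Qed.

Lemma card_slice (i0 : 'I_d) (v : 'I_n) : #|[set r : rows | r i0 == v]| = n ^ d.-1.
Proof.
pose F (i : 'I_d) : pred 'I_(cube d n i) := if i == i0 then pred1 v else predT.
have -> : #|[set r : rows | r i0 == v]| = #|(family F : simpl_pred rows)|.
  apply: eq_card => r; rewrite inE; apply/eqP/familyP => [rv i|/(_ i0)].
    by rewrite /F; case: eqP => // ->; rewrite inE rv.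
  by rewrite /F eqxx inE => /eqP.
rewrite card_family /image_mem foldrE big_map big_enum /= (bigD1 i0) //= /F eqxx card1 mul1n.
rewrite (eq_bigr (fun=> n)) => [|i /negbTE ii]; last by rewrite ii card_ord.
by rewrite prod_nat_const cardC1 card_ord.
Qed.

Lemma card_slices (i0 : 'I_d) (F : 'I_n -> nat) :
  \sum_(r : rows) F (r i0) = n ^ d.-1 * \sum_(v < n) F v.
Proof.
rewrite (partition_big (fun r : rows => r i0 : 'I_n) xpredT) //= big_distrr /=.
apply: eq_bigr => v _; rewrite -(card_slice i0 v) -sum_nat_const.
by apply: eq_big => [r|r /eqP->]; rewrite ?inE.
Qed.

Definition pattern_rows (R : {set rows}) : Prop := forms_pattern P R /\ #|R| = #|ones P|.

(** Provides the hypothesis [famK] of the abstract bounds, with K = [ex_mx n P]. *)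
Lemma pattern_of_card (X : {set rows}) : ex_mx n P < #|X| ->
  exists2 R, pattern_rows R & R \subset X.
Proof.
move=> ltX; pose M : mx01 (cube d n) := [ffun x => x \in X].
have onesM : ones M = X by apply/setP => x; rewrite inE ffunE.
have [phi phi_mono phiM] : contains M P.
  apply: contrapT => nc; move: ltX; rewrite ltnNge => /negP; apply.
  by rewrite -onesM /ex_mx; apply: (@leq_bigmax_cond _ _ (fun M => #|ones M|)); exact/asboolP.
pose f (x : mx_index p) : rows := [ffun i => phi i (x i)].
have phi_inj i : injective (phi i).
  by move=> a b pab; apply/val_inj; case: (ltngtP a b) => // /phi_mono; rewrite pab ltnn.
exists (f @: ones P); last by apply/fintype.subsetP => _ /imsetP[x xP ->]; rewrite -onesM phiM.
split; last first.
  rewrite card_imset // => x y /ffunP fxy; apply/ffunP => i; apply: (phi_inj i).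
  by have := fxy i; rewrite !ffunE.
exists (fun i a => Posz (phi i a)) => [i a b /phi_mono|]; first by rewrite ltz_nat.
apply/seteqP; split=> [_ [y /imsetP[x xP ->] <-]|_ [x xP <-]] /=.
  by exists x => //; apply/funext => i; rewrite ffunE.
by exists (f x); [exact: imset_f|apply/funext => i; rewrite ffunE].
Qed.

Definition row_entry (M : mx01 (cube d.+1 n)) (y : nat) (r : rows) : bool :=
  if insub y is Some y' then M (add1 y' r) else false.

Lemma card_ones_weight (M : mx01 (cube d.+1 n)) : #|ones M| = weight (row_entry M) 0 n [set: rows].
Proof.
rewrite card_ones_eq /weight [RHS](eq_bigl xpredT) => [|r]; last by rewrite inE.
by apply: eq_bigr => r _; rewrite big_mkord; apply: eq_bigr => y _; rewrite /row_entry valK.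
Qed.

Lemma avoid_row_entry (M : mx01 (cube d.+1 n)) s (X : {set rows}) : 0 < s ->
  avoids_formations M P s -> avoid pattern_rows (row_entry M) s 0 n X.
Proof.
move=> s0 avM R [fR cR] _ /form_choice[f [fP fm]].
pose G (j : 'I_s) := [set z : points | (f j (del1 z) == z ord0) && (del1 z \in R)].
have inG j (z : points) : z \in G j -> f j (del1 z) = z ord0 /\ del1 z \in R.
  by rewrite inE => /andP[/eqP].
have imG j : [set del1 z | z in G j] = R.
  apply/setP => r; apply/imsetP/idP => [[z /inG[_ zR] ->]//|rR].
  have [_ fn _] := fP j r (ltn_ord j) rR.
  by exists (add1 (Ordinal fn) r); rewrite ?inE ?del1_add1 // add1_0 eqxx rR.
have cG j : #|G j| = #|ones P|.
  rewrite -cR -(imG j) card_in_imset // => z z' /inG[fz _] /inG[fz' _] dz.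
  rewrite -[z]add1_del1 -[z']add1_del1 dz; congr add1; apply/val_inj.
  by rewrite /= -fz -fz' dz.
have ordG (j k : 'I_s) : j < k -> forall x y, x \in G j -> y \in G k -> x ord0 < y ord0.
  by move=> jk x y /inG[<- xR] /inG[<- yR]; exact: fm.
have disG j k : j != k -> [disjoint G j & G k].
  move=> jk; apply/pred0P => x /=; apply/negbTE/negP => /andP[xj xk].
  move: jk; rewrite neq_ltn => /orP[jk|kj].
    by have := ordG _ _ jk _ _ xj xk; rewrite ltnn.
  by have := ordG _ _ kj _ _ xk xj; rewrite ltnn.
have imF : [set del1 z | z in \bigcup_j G j] = R.
  apply/setP => r; apply/imsetP/idP => [[z /bigcupP[j _ /inG[_ zR]] ->]//|].
  rewrite -(imG (Ordinal s0)) => /imsetP[z zG ->]; exists z => //.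
  by apply/bigcupP; exists (Ordinal s0).
apply: (avM (\bigcup_j G j)).
  apply/fintype.subsetP => z /bigcupP[j _ /inG[fz zR]]; have [_ _] := fP j _ (ltn_ord j) zR.
  by rewrite fz /row_entry valK add1_del1 inE.
split.
  rewrite -sum1_card partition_disjoint_bigcup // (eq_bigr (fun=> #|ones P|)) => [|j _].
    by rewrite sum_nat_const card_ord.
  by rewrite sum1_card.
exists G; split=> //; split=> //; first by move=> j k; rewrite !imG.
by rewrite imF.
Qed.

Lemma ex_formation_le s i : n <= ack i.+1 3 ->
  ex_formation n P s.+2 <= mu s.+1 s i.+1 * (n ^ d + 2 * 3 ^ s * ex_mx n P * n).
Proof.
move=> ni; apply/bigmax_leqP => M /asboolP avM.
rewrite card_ones_weight; apply: leq_trans (weight_mu pattern_of_card ni (avoid_row_entry _ avM)) _ => //.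
rewrite cardsT card_dep_ffun /image_mem foldrE big_map big_enum /= (eq_bigr (fun=> n)) => [|i' _].
  by rewrite prod_nat_const card_ord.
by rewrite card_ord.
Qed.

(** All ones are placed in one slice orthogonal to direction [i0]; a copy of P would need two
    different values of that coordinate. *)
Lemma ex_mx_ge (i0 : 'I_d) (x y : mx_index p) : x \in ones P -> y \in ones P ->
  x i0 != y i0 -> 0 < n -> n ^ d.-1 <= ex_mx n P.
Proof.
move=> xP yP xy n0; pose v := Ordinal n0.
pose M : mx01 (cube d n) := [ffun r : rows => r i0 == v].
have onesM : ones M = [set r : rows | r i0 == v] by apply/setP => r; rewrite !inE ffunE.
rewrite -(card_slice i0 v) -onesM; apply: (@leq_bigmax_cond _ _ (fun M => #|ones M|)).
apply/asboolP => -[phi phi_mono phiM].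
have phi0 z : z \in ones P -> phi i0 (z i0) = v by move=> /phiM; rewrite inE !ffunE => /eqP.
by move: xy; rewrite neq_ltn => /orP[] /phi_mono; rewrite !phi0 // ltnn.
Qed.

(** In a formation the images of x and y are 1-rows with different coordinates at [i0], both present
    in every group. Projected to the first coordinate and [i0], they form a two-row formation in the
    tiling. *)
Lemma ex_formation_ge (i0 : 'I_d) (x y : mx_index p) s w N S : x \in ones P -> y \in ones P ->
  x i0 != y i0 -> dense_blocks s w N S -> 1 < s -> 0 < N <= n ->
  n ^ d.-1 * (n * w) <= 2 * ex_formation n P s.
Proof.
move=> xP yP xy dS s2 Nn.
pose M : mx01 (cube d.+1 n) := [ffun z : points => tile N S (z ord0) (z (lift ord0 i0))].
have cM : #|ones M| = n ^ d.-1 * \sum_(0 <= y < n) \sum_(0 <= x < n) tile N S y x.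
  rewrite card_ones_eq exchange_big big_mkord [in RHS]big_distrr; apply: eq_bigr => c _ /=.
  rewrite [in RHS]big_mkord -(card_slices i0 (fun v => tile N S c v)).
  by apply: eq_bigr => r _; rewrite ffunE add1_0 !ffunE liftK.
apply: (@leq_trans (2 * #|ones M|)).
  by rewrite cM (mulnCA 2) leq_mul2l (tile_weight dS Nn) ?orbT.
rewrite leq_mul2l /=; apply: (@leq_bigmax_cond _ _ (fun M => #|ones M|)); apply/asboolP.
move=> F /fintype.subsetP FM [_ [G [FE _ _ [imG ordG [phi phi_mono phiS]]]]].
have GM j z : z \in G j -> tile N S (z ord0) (del1 z i0).
  move=> zj; have : z \in ones M by apply: FM; rewrite FE; apply/bigcupP; exists j.
  by rewrite inE !ffunE.
have rowE z : z \in ones P -> exists2 r : rows, Posz (r i0) = phi i0 (z i0) &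
    forall j, r \in [set del1 x | x in G j].
  move=> zP; have [_ /(_ (fun i => phi i (z i))) sub] := (seteqP _ _).1 phiS.
  case: sub => [|r /= /imsetP[u uF ->] rz]; first by exists z.
  exists (del1 u) => [|j]; first by have := congr1 (@^~ i0) rz.
  move: uF; rewrite FE => /bigcupP[k _ uk]; rewrite (imG j k); exact: imset_f.
have colE r : (forall j, r \in [set del1 x | x in G j]) -> exists c : nat -> nat,
    forall (j : nat) (js : (j < s)%N), exists2 z, z \in G (Ordinal js) & z ord0 = c j :> nat /\ del1 z = r.
  move=> rG; have /choice[c cP] : forall j, exists c : nat, forall js : (j < s)%N,
      exists2 z, z \in G (Ordinal js) & z ord0 = c :> nat /\ del1 z = r.
    move=> j; have /orP[sj|js] := leqVgt s j; first by exists 0 => js; have := leq_ltn_trans sj js; rewrite ltnn.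
    have /imsetP[z zG rz] := rG (Ordinal js); exists (z ord0) => js'; exists z => //.
    by have -> : Ordinal js' = Ordinal js by exact: val_inj.
  by exists c.
have [ra raE /colE[ya yaP]] := rowE x xP; have [rb rbE /colE[yb ybP]] := rowE y yP.
apply: (@tile_no_form s w N S (ra i0) (rb i0) ya yb) => //.
  apply/eqP => ab; have pxy : phi i0 (x i0) = phi i0 (y i0) by rewrite -raE -rbE ab.
  by move: xy; rewrite neq_ltn => /orP[] /phi_mono; rewrite pxy ltxx.
split=> [j js|j js|j k jk ks].
- by have [z zG [<- <-]] := yaP j js; exact: GM zG.
- by have [z zG [<- <-]] := ybP j js; exact: GM zG.
- have js := ltn_trans jk ks.
  have [za zaG [<- _]] := yaP j js; have [za' zaG' [<- _]] := yaP k ks.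
  have [zb zbG [<- _]] := ybP j js; have [zb' zbG' [<- _]] := ybP k ks.
  rewrite gtn_max !leq_min; apply/andP; split; apply/andP; split; exact: (ordG (Ordinal js) (Ordinal ks)).
Qed.
End Transfer.
(** * Asymptotics *)

Lemma inv_ack_le n : n <= ack (inv_ack n) 3.
Proof.
rewrite /inv_ack; case: ex_minnP => k nk _.
by apply: leq_trans nk _; exact: leq_ack_lvl.
Qed.

Lemma ack_lt_inv_ack k n : k.+2 <= inv_ack n -> ack k 3 < n.
Proof.
rewrite /inv_ack; case: ex_minnP => m _ min_m km.
by rewrite ltnNge; apply/negP => /min_m; lia.
Qed.

Lemma inv_ack_unbounded a n : ack a 3 < n -> a < inv_ack n.
Proof.
move=> an; rewrite ltnNge; apply/negP => na; move: an; rewrite ltnNge => /negP; apply.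
exact: leq_trans (inv_ack_le n) (leq_ack_lvl 3 na).
Qed.

(** The induction uses 3q because (1 + 1/(3q))^2 <= 1 + 1/q. *)
Lemma expn_shift_le c t q : 0 < q -> exists a0, forall a, a0 <= a ->
  q * (a + c) ^ t <= q.+1 * a ^ t.
Proof.
elim: t q => [|t IHt] q q0; first by exists 0 => a _; rewrite !expn0 !muln1.
have [|a0 IH] := IHt (3 * q); first by lia.
exists (maxn a0 (3 * q * c)) => a; rewrite geq_max => /andP[/IH h1 ca].
have h2 : 3 * q * (a + c) <= (3 * q).+1 * a by rewrite mulSn mulnDr; lia.
rewrite -(@leq_pmul2l (3 * q * (3 * q))) ?muln_gt0 ?q0 //.
apply: (@leq_trans (q * ((3 * q).+1 * (3 * q).+1) * a ^ t.+1)).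
  have := leq_mul (leq_mul (leqnn q) h2) h1; rewrite !expnS.
  by move: (a ^ t) ((a + c) ^ t) => u v; nia.
by rewrite [leqRHS]mulnA leq_mul2r; apply/orP; right; nia.
Qed.

Lemma bin_mul_fact_le m t : 'C(m, t) * t`! <= m ^ t.
Proof.
rewrite bin_ffact; elim: t m => // t IHt [|m]; first by rewrite ffact0n exp0n.
by rewrite ffactSS expnS leq_mul // (leq_trans (IHt m)) // leq_expl.
Qed.

Lemma bin_mul_fact_ge m t : (m - t) ^ t <= 'C(m, t) * t`!.
Proof.
rewrite bin_ffact; elim: t m => // t IHt [|m]; first by rewrite sub0n exp0n.
by rewrite ffactSS expnS subSS leq_mul ?IHt // (leq_trans (leq_subr _ _)).
Qed.

Section Counting.
Variables (d : nat) (p : 'I_d -> nat) (P : mx01 p).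
Variables (i0 : 'I_d) (x y : mx_index p).
Hypotheses (xP : x \in ones P) (yP : y \in ones P) (xy : x i0 != y i0).
Variables (C n0 : nat).
Hypothesis ex_linear : forall n, n0 <= n -> ex_mx n P <= C * n ^ d.-1.

Let d_gt0 : 0 < d. Proof. exact: leq_ltn_trans (ltn_ord i0). Qed.

(** The n^d rows number at most n * [ex_mx n P] by [ex_mx_ge], so the row term has the same form as
    the column term. *)
Lemma ex_formation_upper s n : 0 < n -> ex_formation n P s.+2
  <= (1 + 2 * 3 ^ s) * mu s.+1 s (inv_ack n) * (n * ex_mx n P).
Proof.
move=> n_gt0; have := @ex_formation_le d n p P s (inv_ack n).-1 (inv_ack_le n).
move/leq_trans; apply; rewrite prednK // [leqRHS](mulnC _ (n * _)) [leqRHS]mulnA [leqRHS]mulnC.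
rewrite leq_mul2l; apply/orP; right.
have nd : n ^ d = n * n ^ d.-1 by rewrite -expnS (prednK d_gt0).
have := ex_mx_ge xP yP xy n_gt0; rewrite nd => h.
by have := leq_mul (leqnn n) h; move: (3 ^ s) (n * _) (ex_mx n P) => u v w; nia.
Qed.

(** The assumption on the growth of [ex_mx] enters here: it bounds [ex_mx] by a multiple of the
    factor n^(d-1) coming from the copied coordinates. *)
Lemma ex_formation_lower s w k n :
  (exists N S, dense_blocks s w N S /\ 0 < N <= ack k 3) -> 1 < s ->
  n0 <= n -> k.+2 <= inv_ack n -> n * ex_mx n P * w <= 2 * C * ex_formation n P s.
Proof.
move=> [N [S [dS /andP[N0 Nk]]]] s1 n0n /ack_lt_inv_ack kn.
have Nn : 0 < N <= n by rewrite N0 (leq_trans Nk) // ltnW.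
have := ex_formation_ge xP yP xy dS s1 Nn => h.
have := leq_mul (leqnn (n * w)) (ex_linear n0n); have := leq_mul (leqnn C) h.
by move: (n ^ _) (ex_mx n P) (ex_formation n P s) => u v z; nia.
Qed.

Lemma ex_mx_gt0 n : 0 < n -> 0 < ex_mx n P.
Proof. by move=> n_gt0; apply: leq_trans (ex_mx_ge xP yP xy n_gt0); rewrite expn_gt0 n_gt0. Qed.

Lemma ex_formation4_bounds : exists a b n1, forall n, n1 <= n ->
  n * inv_ack n * ex_mx n P <= a * ex_formation n P 4 /\
  ex_formation n P 4 <= b * (n * inv_ack n * ex_mx n P).
Proof.
(* 13 is 2^3 + 5 from [mu2_le]. Beyond [ack 10 3] the inverse exceeds 10, so that alpha(n) - 5, the
   multiplicity constructed, is at least alpha(n) / 2. *)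
exists (4 * C), ((1 + 2 * 3 ^ 2) * 13), (maxn (maxn n0 1) (ack 10 3).+1) => n.
rewrite !geq_max => /andP[/andP[n0n n_gt0] /inv_ack_unbounded alpha].
split; last first.
  have := ex_formation_upper 2 n_gt0 => /leq_trans; apply.
  have := mu2_le 3 (inv_ack n); move: (mu 3 2 _) (1 + 2 * 3 ^ 2) => u c h.
  have : u <= 13 * inv_ack n by rewrite (leq_trans h) //; lia.
  move=> h'; have := leq_mul (leqnn (c * (n * ex_mx n P))) h'.
  by move: (inv_ack n) (ex_mx n P) => a v; nia.
have := @ex_formation_lower 4 (inv_ack n - 6).+1 (inv_ack n - 6 + 4) n (dense_four _) isT n0n.
move=> /(_ ltac:(lia)); have : inv_ack n <= 2 * (inv_ack n - 6).+1 by lia.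
by move: (inv_ack n - 6).+1 (inv_ack n) (ex_mx n P) => w a v; nia.
Qed.

Lemma ex_formation5_bounds : exists a b n1, forall n, n1 <= n ->
  n * 2 ^ inv_ack n * ex_mx n P <= a * ex_formation n P 5 /\
  ex_formation n P 5 <= b * (n * 2 ^ inv_ack n * ex_mx n P).
Proof.
(* 80 is [2 ^ 4 * 3 + 32] from [mu3_le]. The construction at level alpha(n) - 6 loses 2^6, and
   [ex_formation_lower] another factor 2. *)
exists (2 ^ 7 * C), ((1 + 2 * 3 ^ 3) * 80), (maxn (maxn n0 1) (ack 10 3).+1) => n.
rewrite !geq_max => /andP[/andP[n0n n_gt0] /inv_ack_unbounded alpha].
split; last first.
  have := ex_formation_upper 3 n_gt0 => /leq_trans; apply.
  have := mu3_le 4 (inv_ack n); rewrite -[2 ^ 4 * 3 + 32]/80.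
  move: (mu 4 3 _) (1 + 2 * 3 ^ 3) => u c h.
  have h' : u <= 80 * 2 ^ inv_ack n by apply: leq_trans h; rewrite -!addnA leq_addr.
  have := leq_mul (leqnn (c * (n * ex_mx n P))) h'.
  by move: (2 ^ inv_ack n) (ex_mx n P) => a v; nia.
have [i alphaE] : exists i, inv_ack n = 6 + i by exists (inv_ack n - 6); lia.
have := @ex_formation_lower 5 _ (i + 1 + 3) n (dense_odd i (ltn0Sn 0)) isT n0n.
have -> : lgmult 1 i = i by rewrite /lgmult bin1 addn1.
move=> /(_ ltac:(lia)) h; have := leq_mul (leqnn (2 ^ 6)) h.
rewrite alphaE expnD [2 ^ 7]expnS; move: (2 ^ 6) (2 ^ i) (ex_mx n P) => c w v.
by rewrite !mulnA; move: (ex_formation _ _ _) => z; nia.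
Qed.

Lemma ex_formation_odd_upper t q : 0 < t -> 0 < q -> exists n1, forall n, n1 <= n ->
  ex_formation n P (2 * t + 3) ^ (q * t`!)
  <= 2 ^ (q.+1 * inv_ack n ^ t + 3 * t`! * inv_ack n ^ t) * (n * ex_mx n P) ^ (q * t`!).
Proof.
case: t => // t _ q0; have [_ /(_ q)[D hD]] := mu_growth t.*2.+4 t.
have [a1 ha1] := expn_shift_le t.+1 t.+1 q0.
have [a2 ha2] := expn_shift_le 1 t.+1 (ltn0Sn 0).
pose c := 1 + 2 * 3 ^ t.*2.+3.
exists (maxn 1 (ack (maxn (maxn a1 a2) (q * c + D)) 3).+1) => n.
rewrite geq_max => /andP[n_gt0 /inv_ack_unbounded].
rewrite !gtn_max => /andP[/andP[/ltnW/ha1 h1 /ltnW/ha2 h2] /ltnW h3].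
have := ex_formation_upper t.*2.+3 n_gt0; rewrite -/c (_ : t.*2.+3.+2 = 2 * t.+1 + 3); last by lia.
move: (inv_ack n) hD h1 h2 h3 => a hD h1 h2 h3; move: (ex_formation _ _ _) => z.
move: (n * _) => v hz; rewrite -(@leq_exp2r _ _ (q * (t.+1)`!)) ?muln_gt0 ?q0 ?fact_gt0 // in hz.
apply: leq_trans hz _; rewrite expnMn leq_mul2r; apply/orP; right.
rewrite expnMn; apply: (@leq_trans (2 ^ (c * (q * (t.+1)`!)) * 2 ^ ((q * 'C(a + t.+1, t.+1) + a.+1 ^ t.+1 + D) * (t.+1)`!))).
  rewrite leq_mul // [leqRHS]expnM.
    by rewrite leq_expl // ltnW // ltn_expl.
  by rewrite expnM leq_expl.
rewrite -expnD leq_pexp2l //.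
have hC := bin_mul_fact_le (a + t.+1) t.+1; have := leq_mul (leqnn q) hC.
rewrite addn1 mul1n in h2; have := leq_mul h2 (leqnn (t.+1)`!).
have a_le : a <= a ^ t.+1 by case: (a) => // a'; rewrite -{1}[a'.+1]expn1 leq_pexp2l.
have := leq_mul (leq_trans h3 a_le) (leqnn (t.+1)`!).
move: h1; move: ((a + t.+1) ^ _) (a.+1 ^ _) (a ^ _) ('C(_, _)) ((t.+1)`!) => r1 r2 r3 r4 r5.
nia.
Qed.

(** The exponent [lgmult] of the construction is at least b^t / t! with b = alpha(n) - t - 6, and
    the shift costs a factor q / (q + 1) by [expn_shift_le]. The power 2^(alpha^t) on the right
    absorbs the constant [2 * C]. *)
Lemma ex_formation_odd_lower t q : 0 < t -> 0 < q -> exists n1, forall n, n1 <= n ->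
  (n * ex_mx n P) ^ (q.+1 * t`!) * 2 ^ (q * inv_ack n ^ t)
  <= 2 ^ (inv_ack n ^ t) * ex_formation n P (2 * t + 3) ^ (q.+1 * t`!).
Proof.
move=> t0 q0; have [b0 hb0] := expn_shift_le (t + 6) t q0.
pose c := 2 * C * (q.+1 * t`!).
exists (maxn n0 (ack (maxn (b0 + (t + 6)) c) 3).+1) => n.
rewrite geq_max => /andP[n0n /inv_ack_unbounded]; rewrite !gtn_max => /andP[ab ca].
have [b alphaE] : exists b, inv_ack n = b + (t + 6) by exists (inv_ack n - (t + 6)); lia.
have := @ex_formation_lower _ _ (b.+1 + t + 3) n (dense_odd b.+1 t0) isT n0n.
rewrite alphaE (_ : t.+1.*2.+1 = 2 * t + 3); last by lia.
move=> /(_ ltac:(lia)); rewrite alphaE in ab ca; have {}hb0 := hb0 b ltac:(lia).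
have := bin_mul_fact_ge (b.+1 + t).-1 t; rewrite addSn /= addnK -/(lgmult t b.+1).
move: (lgmult t b.+1) => l hl; move: (ex_formation _ _ _) (n * _) => z v hz.
rewrite -(@leq_exp2r _ _ (q.+1 * t`!)) ?muln_gt0 ?fact_gt0 // !expnMn in hz.
apply: (@leq_trans (v ^ (q.+1 * t`!) * (2 ^ l) ^ (q.+1 * t`!))).
  rewrite leq_mul2l -expnM leq_pexp2l ?orbT //; apply: leq_trans hb0 _.
  by rewrite mulnCA leq_mul2l hl orbT.
apply: leq_trans hz _; rewrite leq_mul2r -expnMn; apply/orP; right.
apply: (@leq_trans (2 ^ c)); first by rewrite /c (expnM 2 (2 * C)) leq_expl // ltnW // ltn_expl.
rewrite leq_pexp2l //; apply: leq_trans (ltnW ca) _.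
by case: (b + _) => // a; rewrite -{1}[a.+1]expn1 leq_pexp2l.
Qed.
End Counting.
Local Open Scope classical_set_scope.
Local Open Scope ring_scope.

(** * Passage to real asymptotics *)

Lemma eqTheta_natr (R : realType) (f g : nat -> nat) :
  (exists a b n1, forall n, (n1 <= n)%N -> (g n <= a * f n)%N /\ (f n <= b * g n)%N) ->
  (fun n : nat => (f n)%:R : R) =Theta_\oo (fun n : nat => (g n)%:R : R).
Proof.
move=> [a [b [n1 fg]]]; rewrite eqThetaE qualifE; apply/asboolP.
exists (a.+1%:R^-1, b.+1%:R); first by rewrite /= invr_gt0 !ltr0n.
near=> n; have [] := fg n; first by near: n; exact: nbhs_infty_ge.
move=> ga fb /=; rewrite !ger0_norm ?ler0n //; split.
  rewrite ler_pdivrMl ?ltr0n // -natrM ler_nat (leq_trans ga) //.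
  by rewrite leq_mul2r leqnSn orbT.
by rewrite -natrM ler_nat (leq_trans fb) // leq_mul2r leqnSn orbT.
Unshelve. all: by end_near. Qed.

Section Log2.
Variable R : realType.
Implicit Types (m a b z v : nat).

Definition log2 (r : R) : R := ln r / ln 2.

Lemma ln2_gt0 : 0 < ln (2 : R).
Proof. by rewrite ln_gt0 // ltr1n. Qed.

Lemma powR_log2 (r : R) : 0 < r -> 2 `^ log2 r = r.
Proof.
move=> r0; rewrite /powR pnatr_eq0 /= /log2 divfK ?lnK ?posrE //.
by rewrite gt_eqF // ln2_gt0.
Qed.

Lemma log2_ratio z v : (0 < z)%N -> (0 < v)%N ->
  ln (z%:R / v%:R : R) = ln z%:R - ln v%:R.
Proof. by move=> z0 v0; rewrite ln_div ?posrE ?ltr0n. Qed.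

Lemma ln_nat_le m n : (0 < m)%N -> (m <= n)%N -> ln (m%:R : R) <= ln n%:R.
Proof. by move=> m0 mn; rewrite ler_ln ?posrE ?ltr0n ?ler_nat // (leq_trans m0). Qed.

Lemma ln_natM m n : (0 < m)%N -> (0 < n)%N -> ln ((m * n)%:R : R) = ln m%:R + ln n%:R.
Proof. by move=> m0 n0; rewrite natrM lnM ?posrE ?ltr0n. Qed.

Lemma ln_natX m n : (0 < m)%N -> ln ((m ^ n)%:R : R) = n%:R * ln m%:R.
Proof. by move=> m0; rewrite natrX lnXn ?ltr0n // mulr_natl. Qed.

Lemma log2_le m a z v : (0 < z)%N -> (0 < v)%N -> (z ^ m <= 2 ^ a * v ^ m)%N ->
  m%:R * log2 (z%:R / v%:R) <= a%:R.
Proof.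
move=> z0 v0 zv; have := @ln_nat_le (z ^ m) _ _ zv; rewrite expn_gt0 z0 => /(_ isT).
rewrite ln_natM ?expn_gt0 ?v0 // !ln_natX // => h.
rewrite /log2 log2_ratio // mulrA ler_pdivrMr ?ln2_gt0 // mulrBr; lra.
Qed.

Lemma log2_ge m a b z v : (0 < z)%N -> (0 < v)%N -> (v ^ m * 2 ^ a <= 2 ^ b * z ^ m)%N ->
  a%:R - b%:R <= m%:R * log2 (z%:R / v%:R).
Proof.
move=> z0 v0 zv; have := @ln_nat_le (v ^ m * 2 ^ a) _ _ zv; rewrite muln_gt0 !expn_gt0 v0 => /(_ isT).
rewrite !ln_natM ?expn_gt0 ?v0 ?z0 // !ln_natX // => h.
rewrite /log2 log2_ratio // mulrA ler_pdivlMr ?ln2_gt0 // mulrBr mulrBl; lra.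
Qed.
End Log2.

(** Applied with X = alpha(n)^t, T = t! and L the logarithm of the ratio. The estimates place T L -
    X between -2X/(q + 1) and (1 + 3T)X/q, and both are at most 4TX/q in absolute value as T >=
    1. *)
Lemma ln_error_bound (R : realFieldType) (X T q L : R) : 0 <= X -> 1 <= T -> 0 < q ->
  q * T * L <= (q + 1) * X + 3 * T * X -> q * X - X <= (q + 1) * T * L ->
  `|L - T^-1 * X| <= 4 / q * X.
Proof.
move=> X0 T1 q0 up lo; have T0 : 0 < T by apply: lt_le_trans T1.
have -> : L - T^-1 * X = (T * L - X) / T by field; rewrite gt_eqF.
have -> : 4 / q * X = (4 * T * X) / q / T by field; rewrite !gt_eqF.
have iT0 : 0 < T^-1 by rewrite invr_gt0.
rewrite normrM (gtr0_norm iT0) ler_pM2r //.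
have XT : X <= T * X by rewrite ler_peMl.
rewrite ler_norml ler_pdivlMr // -mulNr; apply/andP; split; last by rewrite mulrBl; nra.
rewrite ler_pdivrMr //.
have h : q * (T * L - X) + (T * L - X) >= - 2 * X by nra.
have [|] := leP 0 (T * L - X); nra.
Qed.

Theorem theorem3 (R : realType) (d : nat) (hd : (1 <= d)%N)
    (p : 'I_d -> nat) (P : mx01 p) (hP : (2 <= #|ones P|)%N)
    (hex : (fun n : nat => (ex_mx n P)%:R : R)
             =O_\oo (fun n : nat => n%:R ^+ d.-1 : R)) :
  [/\ (fun n : nat => (ex_formation n P 4)%:R : R)
        =Theta_\oo (fun n : nat => n%:R * (inv_ack n)%:R * (ex_mx n P)%:R : R),
      (fun n : nat => (ex_formation n P 5)%:R : R)
        =Theta_\oo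
          (fun n : nat => n%:R * 2 ^+ inv_ack n * (ex_mx n P)%:R : R)
    & forall t : nat, (1 <= t)%N ->
        exists2 e : nat -> R,
          e =o_\oo (fun n : nat => (inv_ack n)%:R ^+ t : R)
        & \forall n \near \oo,
            (ex_formation n P (2 * t + 3))%:R
            = (ex_mx n P)%:R * n%:R
              * 2 `^ (t`!%:R^-1 * (inv_ack n)%:R ^+ t + e n)].
Proof.
have [x [y [xP yP xy]]] : exists x y, [/\ x \in ones P, y \in ones P & x != y].
  by have /card_gt1P := hP.
have [i0 xy0] : exists i0, x i0 != y i0.
  apply: contrapT => nex; move: xy => /eqP; apply; apply/ffunP => i.
  by apply: contrapT => /eqP xyi; apply: nex; exists i.
have [C [n0 exC]] : exists C n0, forall n, (n0 <= n)%N -> (ex_mx n P <= C * n ^ d.-1)%N.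
  have /eqO_exP[k k0 [n0 _ hk]] := hex.
  exists (Num.bound k), n0 => n n0n; have := hk n n0n; rewrite /= !ger0_norm ?exprn_ge0 ?ler0n //.
  rewrite -natrX => h; rewrite -(ler_nat R) natrM (le_trans h) //.
  by rewrite ler_wpM2r ?ler0n // ltW // archi_boundP // ltW.
split.
- have -> : (fun n : nat => n%:R * (inv_ack n)%:R * (ex_mx n P)%:R : R)
      = (fun n => (n * inv_ack n * ex_mx n P)%:R) by apply/funext => n; rewrite !natrM.
  by apply: eqTheta_natr; exact (ex_formation4_bounds xP yP xy0 exC).
- have -> : (fun n : nat => n%:R * 2 ^+ inv_ack n * (ex_mx n P)%:R : R)
      = (fun n => (n * 2 ^ inv_ack n * ex_mx n P)%:R) by apply/funext => n; rewrite !natrM natrX.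
  by apply: eqTheta_natr; exact (ex_formation5_bounds xP yP xy0 exC).
move=> t t0; pose z n := ex_formation n P (2 * t + 3); pose v n := (n * ex_mx n P)%N.
have v_gt0 n : (0 < n)%N -> (0 < v n)%N by move=> n_gt0; rewrite muln_gt0 n_gt0 (ex_mx_gt0 xP yP xy0).
have z_gt0 n1 n : (forall n, (n1 <= n)%N -> (v n ^ (2 * t`!) * 2 ^ (1 * inv_ack n ^ t)
    <= 2 ^ (inv_ack n ^ t) * z n ^ (2 * t`!))%N) -> (n1 <= n)%N -> (0 < n)%N -> (0 < z n)%N.
  move=> /[apply] h n_gt0; rewrite lt0n; apply/eqP => z0; move: h; rewrite z0 exp0n ?muln_gt0 ?fact_gt0 //.
  by rewrite muln0 leqn0 muln_eq0 !expn_eq0 /= -leqn0 leqNgt v_gt0.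
(* The lower bound for q = 1 already makes [z n] positive, so that its ratio to [v n] is the
   exponential of its logarithm. *)
have [m0 hm0] := ex_formation_odd_lower xP yP xy0 exC t0 (ltn0Sn 0).
(* With the exact discrepancy as error term the identity is immediate, and only its size remains to
   be estimated. *)
exists (fun n => log2 ((z n)%:R / (v n)%:R) - t`!%:R^-1 * (inv_ack n)%:R ^+ t); last first.
  near=> n; have n_gt0 : (0 < n)%N by near: n; exact: nbhs_infty_gt.
  have zn : (0 < z n)%N by apply: z_gt0 hm0 _ n_gt0; near: n; exact: nbhs_infty_ge.
  rewrite addrC subrK powR_log2 ?divr_gt0 ?ltr0n ?v_gt0 //.
  by rewrite /v natrM -/(z n) mulrC (mulrC n%:R) divfK // mulf_neq0 ?pnatr_eq0 -?lt0n // (ex_mx_gt0 xP yP xy0).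
apply/eqoP => eps eps0.
have [q q0 q_eps] : exists2 q, (0 < q)%N & 4 / q%:R <= eps.
  exists (Num.bound (4 / eps)).+1 => //; have h4 : 0 <= 4 / eps by apply: divr_ge0 => //; exact: ltW.
  rewrite ler_pdivrMr ?ltr0n // mulrC -ler_pdivrMr //.
  by apply: le_trans (ltW (archi_boundP h4)) _; rewrite ler_nat.
have [m1 hm1] := ex_formation_odd_upper xP yP xy0 t0 q0.
have [m2 hm2] := ex_formation_odd_lower xP yP xy0 exC t0 q0.
near=> n; have n_gt0 : (0 < n)%N by near: n; exact: nbhs_infty_gt.
have zn : (0 < z n)%N by apply: z_gt0 hm0 _ n_gt0; near: n; exact: nbhs_infty_ge.
have n1 : (m1 <= n)%N by near: n; exact: nbhs_infty_ge.
have n2 : (m2 <= n)%N by near: n; exact: nbhs_infty_ge.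
have up := @log2_le R _ _ _ _ zn (v_gt0 n n_gt0) (hm1 n n1).
have lo := @log2_ge R _ _ _ _ _ zn (v_gt0 n n_gt0) (hm2 n n2).
rewrite (ger0_norm (x := _ ^+ t)) ?exprn_ge0 ?ler0n //.
apply: le_trans (ler_wpM2r _ q_eps); last by rewrite exprn_ge0 ?ler0n.
apply: ln_error_bound; rewrite ?exprn_ge0 ?ler0n ?ltr0n // ?ler1n ?fact_gt0 //.
- by move: up; rewrite /v natrD !natrM !natrX -(natr1 q).
- by move: lo; rewrite /v !natrM !natrX -(natr1 q).
Unshelve. all: by end_near. Qed.
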